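(* Let $\sigma\in C(\mathbb{R})$ be not a polynomial, let $\mathbf{a}^1,\dots,\mathbf{a}^k\in\mathbb{R}^d\setminus\{\mathbf{0}\}$, let $W_1=\{t_1\mathbf{a}^1,\dots,t_k\mathbf{a}^k:\ t_1,\dots,t_k\in\mathbb{R}\}$ (the union of the $k$ lines spanned by the $\mathbf{a}^i$) be the set of weights, and let $X$ be a compact subset of $\mathbb{R}^d$. Then: (1) if $\bigcap_{n=1}^\infty\tau^n(X)=\emptyset$, then $\mathcal{M}_X(\sigma;W_1,\mathbb{R})$ is dense in $C(X)$; (2) if $\mathcal{M}_X(\sigma;W_1,\mathbb{R})$ is dense in $C(X)$, then $X$ does not contain cycles with respect to the directions $\mathbf{a}^1,\dots,\mathbf{a}^k$.
   Context: $C(X)$ is the space of real continuous functions on $X$ with the uniform norm. $\mathcal{M}_X(\sigma;W_1,\mathbb{R})$ is the set of restrictions to $X$ of functions in $\mathrm{span}\{\sigma(\mathbf{w}\cdot\mathbf{x}-\theta):\mathbf{w}\in W_1,\ \theta\in\mathbb{R}\}$. Let $p_i(\mathbf{x})=\mathbf{a}^i\cdot\mathbf{x}$. For $Z\subset X$ put $\tau_i(Z)=\{\mathbf{x}\in Z:\ |p_i^{-1}(p_i(\mathbf{x}))\cap Z|\ge2\}$, $i=1,\dots,k$, where $|\cdot|$ denotes cardinality, $\tau(Z)=\bigcap_{i=1}^k\tau_i(Z)$, and inductively $\tau^1=\tau$, $\tau^{n+1}(Z)=\tau(\tau^n(Z))$. A finite set of (distinct) points $\{\mathbf{x}^1,\dots,\mathbf{x}^n\}\subset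 X$ is a cycle with respect to $\mathbf{a}^1,\dots,\mathbf{a}^k$ if there is a vector $(\lambda_1,\dots,\lambda_n)$ with all coordinates nonzero real numbers such that $\sum_{j=1}^n\lambda_j\delta_{\mathbf{a}^i\cdot\mathbf{x}^j}=0$ for $i=1,\dots,k$, where $\delta_a$ is the characteristic function of $\{a\}\subset\mathbb{R}$. *)

(* Defs.v *)
From HB Require Import structures.
From mathcomp Require Import all_boot all_order all_algebra.
From mathcomp Require Import all_classical all_reals all_analysis.
Import Order.TTheory GRing.Theory Num.Theory.
Import numFieldNormedType.Exports.

Set Implicit Arguments.
Unset Strict Implicit.
Unset Printing Implicit Defensive.

Local Open Scope classical_set_scope.
Local Open Scope card_scope.
Local Open Scope ring_scope.

Definition dot (R : realType) (d : nat) (w x : 'rV[R]_d) : R :=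
  \sum_(l < d) w ord0 l * x ord0 l.

(* The span of [vector.v] is restricted to finite-dimensional spaces. *)
Definition lin_span (R : realType) (V : lmodType R) (A : set V) : set V :=
  [set v | exists (n : nat) (c : 'I_n -> R) (u : 'I_n -> V),
     (forall j, A (u j)) /\ v = \sum_(j < n) c j *: u j].

Definition neuron (R : realType) (d : nat) (sigma : R -> R)
    (w : 'rV[R]_d) (theta : R) : 'rV[R]_d -> R :=
  fun x => sigma (dot w x - theta).

Definition networks (R : realType) (d : nat) (sigma : R -> R)
    (W : set 'rV[R]_d) : set ('rV[R]_d -> R) :=
  lin_span [set g | exists w theta, W w /\ g = neuron sigma w theta].

Definition networks_on (R : realType) (d : nat) (X : set 'rV[R]_d)
    (sigma : R -> R) (W : set 'rV[R]_d) : set (X -> R) :=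
  [set sigL X g | g in networks sigma W].
Arguments networks_on {R d} X sigma W.

Definition union_of_lines (R : realType) (d k : nat) (a : 'I_k -> 'rV[R]_d) :
    set 'rV[R]_d :=
  [set w | exists (i : 'I_k) (t : R), w = t *: a i].

Definition proj (R : realType) (d k : nat) (a : 'I_k -> 'rV[R]_d) (i : 'I_k) :
    'rV[R]_d -> R :=
  fun x => dot (a i) x.

(* [`I_2 #<= A] says that A has at least two elements. *)
Definition tau_dir (R : realType) (d k : nat) (a : 'I_k -> 'rV[R]_d)
    (i : 'I_k) (Z : set 'rV[R]_d) : set 'rV[R]_d :=
  [set x | Z x /\ `I_2 #<= proj a i @^-1` [set proj a i x] `&` Z].

Definition tau (R : realType) (d k : nat) (a : 'I_k -> 'rV[R]_d)
    (Z : set 'rV[R]_d) : set 'rV[R]_d :=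
  \bigcap_(i in [set: 'I_k]) tau_dir a i Z.

(* [\1_[set s]] is the characteristic function delta_s of {s}. The condition
   [0 < n] excludes the empty set, which is not a cycle. *)
Definition cycle_wrt (R : realType) (d k : nat) (a : 'I_k -> 'rV[R]_d)
    (n : nat) (x : 'I_n -> 'rV[R]_d) : Prop :=
  [/\ (0 < n)%N, injective x &
   exists lambda : 'I_n -> R, (forall j, lambda j != 0) /\
     forall i : 'I_k,
       \sum_(j < n) lambda j *: (\1_[set dot (a i) (x j)] : R -> R) = 0].

Definition contains_cycle (R : realType) (d k : nat) (a : 'I_k -> 'rV[R]_d)
    (X : set 'rV[R]_d) : Prop :=
  exists (n : nat) (x : 'I_n -> 'rV[R]_d),
    (forall j, X (x j)) /\ cycle_wrt a x.

(* C(T) is the type [continuousType T R] of continuous functions, with the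
   topology of uniform convergence induced by [arrow_uniform_type T R]. When T
   is compact this is the topology of the uniform norm, see [dense_in_CP]. For
   X a subset of a topological space, C(X) is obtained with T the subtype
   [set_type X], which carries the induced topology. *)
Definition dense_in_C (R : realType) (T : topologicalType) (M : set (T -> R)) :
    Prop :=
  @dense (initial_topology
           (fun f : continuousType T R => (f : arrow_uniform_type T R)))
    [set f : continuousType T R | M f].

Definition uniform_norm (R : realType) (T : Type) (f : T -> R) : R :=
  sup (range (fun x => `|f x|)).

Lemma dense_in_CP (R : realType) (T : topologicalType) (M : set (T -> R)) :
  compact [set: T] ->
  dense_in_C M <->
  forall (f : continuousType T R) (e : R), 0 < e ->
    exists2 g : continuousType T R, M g &
      uniform_norm ((f : T -> R) - (g : T -> R)) < e.
Proof.
move=> cT; split.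
  move=> dM f e e0.
  pose C := initial_topology
           (fun f : continuousType T R => (f : arrow_uniform_type T R)).
  have e20 : 0 < e / 2 by rewrite divr_gt0.
  have nf : nbhs (f : C) (ball (f : C) (e / 2)) by exact: nbhsx_ballx.
  have [|g [Og Mg]] := dM _ _ (@open_interior C (ball (f : C) (e / 2))).
    by exists f.
  exists g => //.
  have : ball (f : C) (e / 2) g by exact: interior_subset Og.
  move=> fg.
  rewrite /uniform_norm.
  case: (pselect (exists t : T, True)) => [[t _]|nT].
    apply: (@le_lt_trans _ _ (e / 2)); last by rewrite ltr_pdivrMr// ltr_pMr// ltr1n.
    apply: ge_sup; first by exists (`|f t - g t|), t.
    move=> _ [x _ <-]; exact/ltW/(fg x).
  rewrite [X in sup X](_ : _ = set0) ?sup0//.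
  by rewrite -subset0 => r [x _ _]; apply: nT; exists x.
move=> H O [f Of] oO.
pose C := initial_topology
           (fun f : continuousType T R => (f : arrow_uniform_type T R)).
have : nbhs (f : C) O by exact: open_nbhs_nbhs.
move=> /nbhs_ballP[e /= e0 feO].
have [g Mg fg] := H f e e0.
exists g; split => //.
suff fge : forall x, `|f x - g x| < e by exact: (feO g fge).
move=> x.
apply: le_lt_trans fg; rewrite /uniform_norm.
apply: ub_le_sup; last by exists x.
have cfg : compact (range (fun x => `|f x - g x|)).
  apply: continuous_compact => //; apply: continuous_subspaceT => y.
  apply: cvg_norm; apply: cvgB; exact: cts_fun.
have [N [_ /(_ (N + 1))]] := compact_bounded cfg.
rewrite ltrDl ltr01 => /(_ isT) bN.
exists (N + 1) => _ [y _ <-].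
have := bN _ (ex_intro2 _ _ y I erefl).
by rewrite /= normr_id.
Qed.

(* Main.v *)
Require Import Defs.
From HB Require Import structures.
From mathcomp Require Import all_boot all_order all_algebra.
From mathcomp Require Import all_classical all_reals all_analysis.
From mathcomp Require Import ring lra.
Import Order.TTheory GRing.Theory Num.Theory.
Import numFieldNormedType.Exports.

(* (1) If the networks are not dense, Hahn-Banach gives a nonzero functional L
   of norm at most 1 on C(X) that kills them. Since sigma is not a polynomial,
   L kills every g(a^i . x), g continuous: the closed span of the functions
   s |-> sigma(t s + b) contains s^n for each n, by differentiating n times in
   t and averaging over b. Let m(U) be the supremum of L f for |f| <= 1
   vanishing off the open set U, i.e. the total variation of the measure
   representing L. If m vanishes off Z, it vanishes on the set of points of Z
   alone in their fiber of a^i . x, because there every f factors through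
   a^i . x. Hence m vanishes off tau(Z), then off each tau^n(X), and by countable
   subadditivity off their intersection, so L = 0. Only values of m on open sets
   are used: no measure is constructed and no measurability of tau^n(X) is
   needed.

   (2) A cycle gives the nonzero functional f |-> sum_j lambda_j f(x^j), which
   kills every function of a^i . x, hence the networks. *)

Local Open Scope classical_set_scope.
Local Open Scope ring_scope.

(** * Univariate approximation by dilates and translates *)

Section Antiderivative.
Context {R : realType}.
Implicit Types (f G : R -> R) (x y a b e : R).

(** Only [x] is confined to the segment; [y] may leave it, so no enlarged segment is needed when
    perturbed arguments are estimated. *)
Lemma uniformly_continuous_segment f b e : continuous f -> 0 < e ->
  exists2 r, 0 < r & forall x y, `|x| <= b -> `|x - y| <= r ->
    `|f x - f y| <= e.
Proof.
move=> cf e0; have /compact_near_coveringP := @segment_compact R (- b) b.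
move=> /(_ R (0^'+) (fun r x => forall y, `|x - y| <= r -> `|f x - f y| <= e) _).
case=> [x _|r /= r0 hr].
  have e20 : 0 < e / 2 by rewrite divr_gt0.
  have /cvgrPdist_lt /(_ _ e20) /nbhs_ballP [r /= r0 hr] := cf x.
  have r20 : 0 < r / 2 by rewrite divr_gt0.
  exists (ball x (r / 2), [set s | s < r / 2]) => /=.
    split; first exact: nbhsx_ballx.
    exact: nbhs_right_lt.
  move=> [z s] /= [xz sr] y zy.
  have xy : `|x - y| < r.
    rewrite (_ : x - y = (x - z) + (z - y)); last by rewrite addrA subrK.
    by apply: le_lt_trans (ler_normD _ _) _; rewrite /ball /= in xz; lra.
  have xz' : `|x - z| < r by rewrite /ball /= in xz; lra.
  have := hr _ xy; have := hr _ xz'; rewrite /= distrC => h1 h2.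
  rewrite (_ : f z - f y = (f z - f x) + (f x - f y)); last by rewrite addrA subrK.
  by apply: le_trans (ler_normD _ _) _; lra.
exists (r / 2) => [|x y xb]; first by rewrite divr_gt0.
apply: (hr (r / 2)) => /=; rewrite ?divr_gt0 //.
  by rewrite sub0r normrN gtr0_norm ?divr_gt0 //; lra.
by rewrite in_itv /= -ler_norml.
Qed.

Lemma mean_value f G a x y : (forall z, a < z -> is_derive z 1 G (f z)) ->
  a < x -> a < y ->
  exists2 z, `|z - x| <= `|y - x| & G y - G x = f z * (y - x).
Proof.
move=> dG.
have mv u v : a < u -> u <= v ->
    exists2 z, u <= z <= v & G v - G u = f z * (v - u).
  move=> au uv.
  have [z|z|z zuv ->] := @MVT_segment R G f u v uv.
  - by rewrite in_itv /= => /andP[uz _]; apply: dG; exact: lt_trans uz.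
  - apply: continuous_in_subspaceT z => z; rewrite inE /= in_itv /= => /andP[uz _].
    apply: differentiable_continuous; apply/derivable1_diffP.
    by have [] := dG z (lt_le_trans au uz).
  - by exists z => //; rewrite in_itv /= in zuv.
move=> ax ay; have [xy|yx] := leP x y.
  have [z /andP[xz zy] ->] := mv x y ax xy; exists z => //.
  by rewrite !ger0_norm ?subr_ge0 //; lra.
have [z /andP[yz zx] e] := mv y x ay (ltW yx); exists z.
  by rewrite !ler0_norm ?subr_le0 //; [lra|exact: ltW].
by rewrite -opprB e; lra.
Qed.

(** [G] is the integral from [a], which is a primitive only to the right of its base point. *)
Lemma antiderivative_ray f a : continuous f ->
  exists G, forall x, a < x -> is_derive x 1 G (f x).
Proof.
move=> cf; eexists => x ax.
have [||||d e] := @continuous_FTC1 R f (BLeft a) x (x + 1).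
- by rewrite ltrDl.
- apply: continuous_compact_integrable; first exact: segment_compact.
  exact: continuous_subspaceT.
- by rewrite lte_fin.
- exact: cf.
by apply: DeriveDef; [exact: d|rewrite -e derive1E].
Qed.

(** The primitives on the rays above [- n], normalized to vanish at 0, agree wherever both are
    defined, since their difference has derivative 0. They therefore glue: at [x] use any ray that
    contains [x]. *)
Lemma antiderivative f : continuous f ->
  exists G, forall x, is_derive x 1 G (f x).
Proof.
move=> cf; have /choice [G hG] := fun n : nat => antiderivative_ray f (- n%:R) cf.
have GE m n x : (0 < m)%N -> (0 < n)%N -> - m%:R < x -> - n%:R < x ->
    G m x - G m 0 = G n x - G n 0.
  move=> m0 n0 mx nx; pose a : R := Num.max (- m%:R) (- n%:R).
  have m0' : - m%:R < 0 :> R by rewrite oppr_lt0 ltr0n.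
  have n0' : - n%:R < 0 :> R by rewrite oppr_lt0 ltr0n.
  have [|||z _] := @mean_value (fun=> 0) (G m - G n) a 0 x.
  - move=> z; rewrite gt_max => /andP[mz nz].
    rewrite -(subrr (f z)); apply: is_deriveB; exact: hG.
  - by rewrite gt_max m0' n0'.
  - by rewrite gt_max mx nx.
  by rewrite mul0r !fctE; lra.
pose N (x : R) := (Num.truncn `|x|).+1.
have hN x : - (N x)%:R < x.
  rewrite ltrNl; apply: le_lt_trans (truncnS_gt `|x|).
  by rewrite -normrN ler_norm.
exists (fun x => G (N x) x - G (N x) 0) => x.
apply: (@near_eq_is_derive _ _ _ (G (N x) - cst (G (N x) 0))).
  have : \forall y \near x, - (N x)%:R < y by exact: (lt_nbhsr (hN x)).
  by apply: filterS => y xy; rewrite !fctE; exact: GE.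
rewrite -[f x]subr0; apply: is_deriveB; exact: hG.
Qed.

End Antiderivative.

(** * Finite differences and the characterization of polynomials *)

Section FiniteDifferences.
Context {R : realType}.
Implicit Types (f u : R -> R) (x y h : R) (p : {poly R}).

Definition fdiff h f : R -> R := fun y => f (y + h) - f y.

Lemma fdiff_continuous h f : continuous f -> continuous (fdiff h f).
Proof.
move=> cf y; apply: cvgB; last exact: cf.
apply: (@continuous_comp _ _ _ (fun y => y + h) f); last exact: cf.
by apply: cvgD; [exact: cvg_id|exact: cvg_cst].
Qed.

Lemma iter_fdiffB n h f g : iter n (fdiff h) (f - g) =
  iter n (fdiff h) f - iter n (fdiff h) g.
Proof.
elim: n => //= n ->; apply/funext => y; rewrite /fdiff !fctE; lra.
Qed.

(** In the Taylor expansion of [p] at [y] the constant term cancels, so each difference lowers the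
    size by one. *)
Lemma iter_fdiff_poly n h p : (size p <= n)%N ->
  iter n (fdiff h) (horner p) = cst 0.
Proof.
elim: n p => [|n IH] p hp.
  by move: hp; rewrite leqn0 size_poly_eq0 => /eqP ->; apply/funext => y;
    rewrite /= horner0.
pose q := \sum_(i < n) h ^+ i.+1 *: p^`N(i.+1).
rewrite iterSr (_ : fdiff h (horner p) = horner q).
  apply: IH; apply: leq_trans (size_sum _ _ _) _; apply/bigmax_leqP => i _.
  apply: leq_trans (size_scale_leq _ _) _; apply: leq_trans (size_poly _ _) _.
  by rewrite leq_subLR; apply: leq_trans hp _; rewrite addSn ltnS leq_addl.
apply/funext => y; rewrite /fdiff (nderiv_taylor_wide (mulrC _ _) hp).
rewrite big_ord_recl expr0 mulr1 nderivn0 addrAC subrr add0r horner_sum.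
by apply: eq_bigr => i _; rewrite hornerZ mulrC.
Qed.

(** Along the lattice [y + h *+ j] the hypothesis is a linear recurrence of order [n], so [n]
    initial zeros propagate. *)
Lemma iter_fdiff_eq0 n h f : (forall y, iter n (fdiff h) f y = 0) -> forall y,
  (forall j, (j < n)%N -> f (y + h *+ j) = 0) -> forall j, f (y + h *+ j) = 0.
Proof.
elim: n f => [|n IH] f hf y fy j; first exact: hf.
have df0 i : f (y + h *+ i.+1) - f (y + h *+ i) = 0.
  have := IH (fdiff h f) _ y _ i; rewrite /fdiff mulrSr addrA; apply.
    by move=> z; rewrite -iterSr.
  move=> k kn; rewrite -addrA -mulrSr !fy ?subrr //; exact: ltnW.
elim: j => [|j IHj]; first exact: fy.
by have := df0 j; rewrite IHj subr0.
Qed.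

Lemma interpolation (s : seq R) f : uniq s ->
  exists p, (size p <= size s)%N /\ forall x, x \in s -> p.[x] = f x.
Proof.
elim: s => [_|x s IH /= /andP[xs /IH [p [ps pf]]]].
  by exists 0; split => //; rewrite size_poly0.
pose q := \prod_(z <- s) ('X - z%:P).
have qx : q.[x] != 0.
  by rewrite -[_ == 0]/(root q x) root_prod_XsubC.
exists (p + ((f x - p.[x]) / q.[x]) *: q); split.
  apply: leq_trans (size_polyD _ _) _; rewrite geq_max leqW //=.
  by apply: leq_trans (size_scale_leq _ _) _; rewrite size_prod_XsubC.
move=> z; rewrite inE hornerD hornerZ => /predU1P[->|zs].
  by rewrite divfK // addrC subrK.
have /rootP -> : root q z by rewrite root_prod_XsubC.
by rewrite mulr0 addr0 pf.
Qed.

(* For each mesh h the function is polynomial on the lattice h N; the lattices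
   N and (1/q) N share infinitely many points, hence the same polynomial. *)
Lemma Frechet_polynomial n f : continuous f ->
  (forall h y, iter n (fdiff h) f y = 0) -> exists p, forall t, f t = p.[t].
Proof.
move=> cf hf.
have lattice h : h != 0 ->
    exists p, (size p <= n)%N /\ forall j, p.[h *+ j] = f (h *+ j).
  move=> h0; have [|p [sp pf]] := interpolation [seq h *+ j | j <- iota 0 n] f.
    rewrite map_inj_uniq ?iota_uniq // => i j /eqP.
    by rewrite -(mulr_natl h i) -(mulr_natl h j) (inj_eq (mulIf h0)) eqr_nat => /eqP.
  rewrite size_map size_iota in sp; exists p; split => // j.
  have := iter_fdiff_eq0 n h (f - horner p) _ 0 _ j.
  rewrite add0r !fctE => hp; apply/esym/subr0_eq/hp.
    by move=> y; rewrite iter_fdiffB iter_fdiff_poly // fctE hf subrr.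
  move=> i ni; rewrite add0r pf ?subrr //; apply/mapP; exists i => //.
  by rewrite mem_iota.
have [p [sp pf]] := lattice 1 (oner_neq0 _).
have prat q j : f (q.+1%:R^-1 *+ j) = p.[q.+1%:R^-1 *+ j].
  have q0 : q.+1%:R^-1 != 0 :> R by rewrite invr_eq0 pnatr_eq0.
  have [p' [sp' pf']] := lattice _ q0.
  rewrite -pf'; suff -> : p' = p by [].
  apply/subr0_eq/eqP; apply: contraT => pp'.
  (* Both polynomials have size at most [n], so agreement at the [n] integers below [n] already
     forces equality. *)
  have rts : all (root (p' - p)) [seq i%:R | i <- iota 0 n].
    apply/allP => _ /mapP[i _ ->]; rewrite rootE !hornerE subr_eq0 pf.
    have -> : i%:R = q.+1%:R^-1 *+ (q.+1 * i) :> R.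
      by rewrite mulrnA -(mulr_natr q.+1%:R^-1 q.+1) mulVf // pnatr_eq0.
    by rewrite pf'.
  have urts : uniq [seq i%:R : R | i <- iota 0 n].
    by rewrite map_inj_uniq ?iota_uniq // => i i' /eqP; rewrite eqr_nat => /eqP.
  have := max_poly_roots pp' rts urts; rewrite size_map size_iota ltnNge.
  suff -> : (size (p' - p)%R <= n)%N by [].
  by apply: leq_trans (size_polyD _ _) _; rewrite geq_max size_polyN sp'.
exists p; suff v0 t : 0 <= t -> f t - p.[t] = 0.
  move=> t; apply/subr0_eq; have [/v0//|t0] := leP 0 t.
  (* For negative [t], walk from [- t *+ n] by steps of [t]: the first [n] points are nonnegative,
     where [f] and [p] agree, and step [n.+1] lands on [t]. *)
  have := iter_fdiff_eq0 n t (f - horner p) _ (- t *+ n) _ n.+1.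
  rewrite mulrS mulNrn addrCA addNr addr0; apply.
    by move=> y; rewrite iter_fdiffB iter_fdiff_poly // fctE hf subrr.
  move=> j jn; apply: v0.
  by rewrite addrC -opprB -mulrnBr ?(ltnW jn) // oppr_ge0 mulrn_wle0 // ltW.
move=> t0; apply/eqP; rewrite -normr_le0; apply/ler_addgt0Pr => e e0.
rewrite add0r; pose v := f - horner p.
have cv : continuous v.
  by move=> x; apply: cvgB; [exact: cf|exact: continuous_horner].
have /cvgrPdist_lt /(_ _ e0) /nbhs_ballP [r /= r0 hr] := cv t.
have [q _ hq] := near_infty_natSinv_lt (PosNum r0).
have {hq} qr : q.+1%:R^-1 < r := hq q (leqnn q).
have q0 : 0 < q.+1%:R :> R by rewrite ltr0n.
pose j := Num.truncn (t * q.+1%:R).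
have := hr (q.+1%:R^-1 *+ j); rewrite /v !fctE prat subrr subr0 => h.
apply/ltW/h; apply: le_lt_trans qr; rewrite -(ler_pM2r q0) mulVf ?gt_eqF //.
rewrite -[X in _ * X <= _]gtr0_norm // -normrM mulrBl -(mulr_natr q.+1%:R^-1 j) mulrAC.
rewrite mulVf ?gt_eqF // mul1r.
have tq : 0 <= t * q.+1%:R by rewrite mulr_ge0 // ltW.
have := truncn_itv tq; rewrite -/j => /andP[j1 j2].
by rewrite ger0_norm ?subr_ge0 // lerBlDl natr1 ltW.
Qed.

End FiniteDifferences.

(** * Weierstrass approximation by Bernstein polynomials *)

Section Weierstrass.
Context {R : realType}.
Implicit Types (f : R -> R) (x b e : R) (g h : nat -> R).

(* The Bernstein polynomial sum_k C(n,k) x^k (1-x)^(n-k) g(k), computed by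
   conditioning a Bernoulli walk on its first step. *)
Fixpoint bernstein n g : {poly R} :=
  if n is n'.+1 then 'X * bernstein n' (g \o S) + (1 - 'X) * bernstein n' g
  else (g 0%N)%:P.

Lemma bernsteinS n g x : (bernstein n.+1 g).[x] =
  x * (bernstein n (g \o S)).[x] + (1 - x) * (bernstein n g).[x].
Proof. by rewrite /= !hornerE. Qed.

Lemma bernstein_mono n g h x : 0 <= x <= 1 ->
  (forall k, (k <= n)%N -> g k <= h k) ->
  (bernstein n g).[x] <= (bernstein n h).[x].
Proof.
move=> /andP[x0 x1]; elim: n g h => [|n IH] g h gh.
  by rewrite /= !hornerC gh.
rewrite !bernsteinS lerD // ler_wpM2l ?subr_ge0 //; apply: IH => k kn /=.
  exact: gh.
exact/gh/leqW.
Qed.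

(** Second moment of a binomial variable about [c]: variance plus squared bias. The center is
    arbitrary because the first step of the walk shifts it to [c - 1]. *)
Lemma bernstein_quadratic n a b c x :
  (bernstein n (fun k => a + b * (k%:R - c) ^+ 2)).[x] =
  a + b * (n%:R * x * (1 - x) + (n%:R * x - c) ^+ 2).
Proof.
elim: n c => [|n IH] c; first by rewrite /= hornerC; ring.
rewrite bernsteinS IH.
have -> : (fun k => a + b * (k%:R - c) ^+ 2) \o S =
    fun k => a + b * (k%:R - (c - 1)) ^+ 2.
  by apply/funext => k /=; rewrite -natr1; congr (_ + _ * _ ^+ 2); lra.
by rewrite IH -natr1; ring.
Qed.

Lemma continuous_bounded_segment f b : continuous f ->
  exists2 K, 0 <= K & forall x, `|x| <= b -> `|f x| <= K.
Proof.
move=> cf; have : compact (f @` `[- b, b]).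
  apply: continuous_compact; last exact: segment_compact.
  exact: continuous_subspaceT.
move=> /compact_bounded [N [_ hN]].
exists (`|N| + 1) => [|x xb]; first by rewrite addr_ge0.
apply: hN; first by rewrite ltr_pwDr ?ler_norm.
by exists x => //=; rewrite in_itv /= -ler_norml.
Qed.

(** Chebyshev's argument: [f x - g k] is at most [e / 2] when [k / n] is near [x], and otherwise at
    most [2 * K], which a multiple of the squared deviation dominates. Monotonicity of [bernstein]
    then reduces everything to the quadratic case. *)
Lemma Weierstrass_unit f e : continuous f -> 0 < e ->
  exists p : {poly R}, forall x, 0 <= x <= 1 -> `|f x - p.[x]| <= e.
Proof.
move=> cf e0; have e20 : 0 < e / 2 by rewrite divr_gt0.
have [r r0 hr] := uniformly_continuous_segment f 1 _ cf e20.
have [K K0 hK] := continuous_bounded_segment f 1 cf.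
(* With this [n] the variance term, at most [2 * K / r ^+ 2 / n], is below [e / 2]. *)
pose n := (Num.truncn (4 * K / r ^+ 2 / e)).+1.
have n0 : 0 < n%:R :> R by rewrite ltr0n.
have hn : 4 * K / r ^+ 2 / e < n%:R by exact: truncnS_gt.
pose g k := f (k%:R / n%:R).
pose C := 2 * K / r ^+ 2 / n%:R ^+ 2.
have C0 : 0 <= C by rewrite !divr_ge0 ?exprn_ge0 ?mulr_ge0 // ltW.
exists (bernstein n g) => x x01; have /andP[x0 x1] := x01.
have gP k : (k <= n)%N -> `|f x - g k| <= e / 2 + C * (k%:R - n%:R * x) ^+ 2.
  move=> kn; have k01 : `|k%:R / n%:R| <= 1 :> R.
    by rewrite ger0_norm ?divr_ge0 ?ler0n // ler_pdivrMr // mul1r ler_nat.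
  have x01' : `|x| <= 1 by rewrite ger0_norm.
  have [xk|xk] := leP `|x - k%:R / n%:R| r.
    by apply: le_trans (hr _ _ x01' xk) _; rewrite lerDl mulr_ge0 // sqr_ge0.
  apply: le_trans (ler_normB _ _) _.
  have -> : C * (k%:R - n%:R * x) ^+ 2 =
      2 * K / r ^+ 2 * `|x - k%:R / n%:R| ^+ 2.
    rewrite real_normK ?num_real // /C.
    by field; rewrite !gt_eqF //; lra.
  have : 2 * K <= 2 * K / r ^+ 2 * `|x - k%:R / n%:R| ^+ 2.
    rewrite -mulrA ler_peMr ?mulr_ge0 // mulrC ler_pdivlMr ?exprn_gt0 // mul1r.
    by apply: lerXn2r; rewrite ?nnegrE ?normr_ge0 ?(ltW r0) ?(ltW xk).
  by have := hK _ x01'; have := hK _ k01; rewrite -/(g k); lra.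
have Cn : C * (n%:R * x * (1 - x) + (n%:R * x - n%:R * x) ^+ 2) <= e / 2.
  rewrite subrr expr0n /= addr0.
  have xx : x * (1 - x) <= 1 by nra.
  apply: (@le_trans _ _ (C * n%:R)).
    by rewrite ler_wpM2l // -mulrA ler_piMr // ltW.
  rewrite (_ : C * n%:R = 2 * K / r ^+ 2 / n%:R); last first.
    by rewrite /C; field; rewrite !gt_eqF.
  rewrite ler_pdivrMr //; move: hn; rewrite ltr_pdivrMr // => hn.
  by lra.
have up := bernstein_mono n g
  (fun k => (f x + e / 2) + C * (k%:R - n%:R * x) ^+ 2) x x01.
have dn := bernstein_mono n
  (fun k => (f x - e / 2) + (- C) * (k%:R - n%:R * x) ^+ 2) g x x01.
rewrite bernstein_quadratic in up; rewrite bernstein_quadratic mulNr in dn.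
rewrite ler_norml; apply/andP; split.
  have : (bernstein n g).[x] <= f x + e / 2 +
      C * (n%:R * x * (1 - x) + (n%:R * x - n%:R * x) ^+ 2).
    by apply: up => k /gP; rewrite ler_norml; lra.
  by lra.
have : f x - e / 2 -
    C * (n%:R * x * (1 - x) + (n%:R * x - n%:R * x) ^+ 2) <= (bernstein n g).[x].
  by apply: dn => k /gP; rewrite ler_norml mulNr; lra.
by lra.
Qed.

Lemma Weierstrass f b e : continuous f -> 0 < e ->
  exists p : {poly R}, forall x, `|x| <= b -> `|f x - p.[x]| <= e.
Proof.
move=> cf e0; have [c c0 bc] : exists2 c : R, 0 < c & b <= c.
  by exists (`|b| + 1); [rewrite ltr_pwDr|rewrite ler_wpDr // ler_norm].
have [|p hp] := Weierstrass_unit (fun u => f (2 * c * u - c)) e _ e0.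
  move=> u; apply: (@continuous_comp _ _ _ (fun u => 2 * c * u - c) f).
    by apply: cvgB; [apply: cvgM; [exact: cvg_cst|exact: cvg_id]|exact: cvg_cst].
  exact: cf.
exists (p \Po ((2 * c)^-1 *: ('X + c%:P))) => x; rewrite ler_norml => xb.
rewrite horner_comp !hornerE; set u := _ * _.
have xu : x = 2 * c * u - c by rewrite /u; field; rewrite gt_eqF.
rewrite {1}xu; apply: hp; rewrite /u mulrC ler_pdivlMr ?mulr_gt0 //.
rewrite ler_pdivrMr ?mulr_gt0 //; lra.
Qed.

End Weierstrass.

(** * Function spaces closed under locally uniform limits and generated by dilates and translates *)

Section DilationClosure.
Context {R : realType} (V : set (R -> R)).
Implicit Types (f F G : R -> R) (b c e h s t x : R) (m n : nat).
Hypothesis V0 : V 0.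
Hypothesis VP : forall c f g, V f -> V g -> V (c *: f + g).
Hypothesis Vlim : forall f, continuous f ->
  (forall b e, 0 < e -> exists2 g, V g & forall s, `|s| <= b -> `|f s - g s| <= e) ->
  V f.

Lemma closure_sum n (c : 'I_n -> R) (u : 'I_n -> R -> R) :
  (forall j, V (u j)) -> V (\sum_(j < n) c j *: u j).
Proof.
move=> Vu; elim: n c u Vu => [|n IH] c u Vu; first by rewrite big_ord0.
by rewrite big_ord_recl; apply: VP => //; exact: IH.
Qed.

(* [weighted m f] says that V contains the m-th derivative in t of the functions
   s |-> F (t s + b), where f is the m-th derivative of F. *)
Definition weighted m f := forall t b, V (fun s => s ^+ m * f (t * s + b)).

Lemma weighted_continuous m f t b : continuous f ->
  continuous (fun s => s ^+ m * f (t * s + b)).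
Proof.
move=> cf s; apply: cvgM; first exact: exprn_continuous.
apply: (@continuous_comp _ _ _ (fun s => t * s + b) f); last exact: cf.
by apply: cvgD; [apply: cvgM; [exact: cvg_cst|exact: cvg_id]|exact: cvg_cst].
Qed.

Let radius b : exists2 c : R, 1 <= c & forall s, `|s| <= b -> `|s| <= c.
Proof.
exists (`|b| + 1) => [|s sb]; first by rewrite lerDr.
by apply: le_trans sb _; rewrite ler_wpDr // ler_norm.
Qed.

Let affine_bound t b c s : `|s| <= c -> `|t * s + b| <= `|t| * c + `|b|.
Proof.
by move=> sc; apply: le_trans (ler_normD _ _) _; rewrite lerD2r normrM ler_wpM2l.
Qed.

(** Differentiation in [t]: the difference quotients of [F (t * s + b)] converge to
    [s * f (t * s + b)], uniformly for bounded [s], by the mean value theorem. *)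
Lemma weighted_deriv m F f : (forall x, is_derive x 1 F (f x)) ->
  continuous f -> weighted m F -> weighted m.+1 f.
Proof.
move=> dF cf VF t b; apply: Vlim; first exact: weighted_continuous.
move=> b0 e e0; have [c c1 bc] := radius b0.
have c0 : 0 < c by lra.
have cm0 : 0 < c ^+ m.+1 by rewrite exprn_gt0.
have ec0 : 0 < e / c ^+ m.+1 by rewrite divr_gt0.
have [r r0 hr] :=
  uniformly_continuous_segment f (`|t| * c + `|b|) _ cf ec0.
(* For [s] bounded by [c] the displacement [d * s] stays within the modulus [r]. *)
pose d := r / c; have d0 : 0 < d by rewrite divr_gt0.
exists (d^-1 *: (fun s => s ^+ m * F ((t + d) * s + b)) +
    ((- d^-1) *: (fun s => s ^+ m * F (t * s + b)) + 0)).
  by apply: VP; [exact: VF|apply: VP => //; exact: VF].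
move=> s /bc sc; rewrite addr0 !fctE.
pose y := t * s + b.
have ylow : - (`|y| + `|d * s|) - 1 < y.
  by have := ler_norm (- y); rewrite normrN; have := normr_ge0 (d * s); lra.
have ylow' : - (`|y| + `|d * s|) - 1 < y + d * s.
  have := ler_norm (- y); have := ler_norm (- (d * s)); rewrite !normrN; lra.
have [z zy Fz] := mean_value f F _ y (y + d * s) (fun z _ => dF z) ylow ylow'.
rewrite addrAC subrr add0r in zy Fz.
have -> : (t + d) * s + b = y + d * s by rewrite /y; ring.
have -> : s ^+ m.+1 * f y - (d^-1 * (s ^+ m * F (y + d * s)) +
    - d^-1 * (s ^+ m * F y)) = s ^+ m.+1 * (f y - f z).
  have -> : F (y + d * s) = F y + f z * (d * s) by rewrite -Fz; ring.
  by rewrite exprS; field; rewrite gt_eqF.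
rewrite normrM normrX; have yz : `|f y - f z| <= e / c ^+ m.+1.
  apply: hr; first exact: affine_bound.
  rewrite distrC; apply: le_trans zy _; rewrite normrM gtr0_norm //.
  by rewrite /d mulrAC ler_pdivrMr // ler_wpM2l // ltW.
apply: (@le_trans _ _ (c ^+ m.+1 * (e / c ^+ m.+1))).
  by apply: ler_pM => //; apply: lerXn2r; rewrite ?nnegrE // ltW.
by rewrite mulrCA divff ?mulr1 // gt_eqF.
Qed.

(** [fdiff h G] at [t * s + b] integrates [f (t * s + v)] over [v] from [b] to [b + h]. Its Riemann
    sums are combinations of translates of [f], hence in [V], and converge locally uniformly. *)
Lemma weighted_integral m f G h : (forall x, is_derive x 1 G (f x)) ->
  continuous f -> weighted m f -> weighted m (fdiff h G).
Proof.
move=> dG cf Vf t b; have cG : continuous G.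
  move=> x; apply: differentiable_continuous; apply/derivable1_diffP.
  by have [] := dG x.
apply: Vlim.
  by apply: weighted_continuous; exact: fdiff_continuous.
move=> b0 e e0; have [c c1 bc] := radius b0.
have c0 : 0 < c by lra.
have cm0 : 0 < c ^+ m by rewrite exprn_gt0.
have h1 : 0 < `|h| + 1 by rewrite ltr_wpDl.
(* The summed errors amount to at most [|h| * e / (|h| + 1)]; adding 1 covers [h = 0]. *)
have ec0 : 0 < e / c ^+ m / (`|h| + 1) by rewrite !divr_gt0.
have [r r0 hr] :=
  uniformly_continuous_segment f (`|t| * c + (`|b| + `|h|)) _ cf ec0.
pose n := (Num.truncn (`|h| / r)).+1.
have n0 : 0 < n%:R :> R by rewrite ltr0n.
pose w := h / n%:R.
have wr : `|w| <= r.
  rewrite /w normrM normfV (gtr0_norm n0) ler_pdivrMr // mulrC -ler_pdivrMr //.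
  by apply/ltW; exact: truncnS_gt.
exists (\sum_(j < n) w *: (fun s => s ^+ m * f (t * s + (b + w *+ j)))).
  by apply: closure_sum => j; exact: Vf.
move=> s /bc sc; rewrite fct_sumE.
pose y j := t * s + b + w *+ j.
have -> : fdiff h G (t * s + b) = \sum_(j < n) (G (y j.+1) - G (y j)).
  rewrite -(big_mkord xpredT (fun j => G (y j.+1) - G (y j))) telescope_sumr //.
  rewrite /fdiff /y mulr0n addr0 -[w *+ n]mulr_natr /w.
  by rewrite divfK // gt_eqF.
rewrite mulr_sumr -sumrB; apply: le_trans (ler_norm_sum _ _ _) _.
apply: (@le_trans _ _ (\sum_(j < n) `|w| * (e / (`|h| + 1)))); last first.
  rewrite sumr_const card_ord -mulr_natr /w normrM normfV (gtr0_norm n0).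
  rewrite [X in X <= _](_ : _ = `|h| * (e / (`|h| + 1))); last first.
    by field; rewrite !gt_eqF.
  rewrite mulrCA ler_piMr ?(ltW e0) // ler_pdivrMr // mul1r; lra.
apply: ler_sum => j _.
have jlow : - (`|y j| + `|w|) - 1 < y j.
  by have := ler_norm (- y j); rewrite normrN; have := normr_ge0 w; lra.
have yS : y j.+1 = y j + w by rewrite /y mulrSr addrA.
have jlow' : - (`|y j| + `|w|) - 1 < y j + w.
  by have := ler_norm (- y j); have := ler_norm (- w); rewrite !normrN; lra.
have [z zy Gz] := mean_value f G _ (y j) (y j + w) (fun z _ => dG z) jlow jlow'.
rewrite addrAC subrr add0r in zy Gz.
rewrite yS Gz fctE addrA -/(y j).
have -> : s ^+ m * (f z * w) - w * (s ^+ m * f (y j)) =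
  w * (s ^+ m * (f z - f (y j))) by ring.
rewrite normrM ler_wpM2l // normrM normrX.
have yz : `|f z - f (y j)| <= e / c ^+ m / (`|h| + 1).
  rewrite distrC; apply: hr; last by rewrite distrC; exact: le_trans zy wr.
  rewrite /y -addrA; apply: le_trans (affine_bound t (b + w *+ j) c s sc) _.
  rewrite lerD2l; apply: le_trans (ler_normD _ _) _; rewrite lerD2l.
  rewrite normrMn -mulr_natr /w normrM normfV (gtr0_norm n0) mulrAC.
  by rewrite ler_pdivrMr // ler_wpM2l // ler_nat ltnW.
apply: (@le_trans _ _ (c ^+ m * (e / c ^+ m / (`|h| + 1)))).
  by apply: ler_pM => //; apply: lerXn2r; rewrite ?nnegrE // ltW.
by rewrite mulrA mulrCA divff ?mulr1 // gt_eqF.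
Qed.

(** Averaging over [b] first replaces [f], which may have no derivative, by [fdiff h G] with [G] a
    primitive of [f]. This is differentiable with derivative [fdiff h f], so differentiating in [t]
    gains a factor [s]. *)
Lemma weighted_fdiff m f h : continuous f -> weighted m f ->
  weighted m.+1 (fdiff h f).
Proof.
move=> cf Vf; have [G dG] := antiderivative f cf.
apply: (weighted_deriv m (fdiff h G)); last exact: weighted_integral dG cf Vf.
- move=> x; rewrite /fdiff; apply: is_deriveB => //.
  have dGh := dG (x + h).
  rewrite -[f (x + h)]mulr1; apply: (@is_derive1_comp R G (fun y => y + h)).
  exact: is_derive_shift.
- exact: fdiff_continuous.
Qed.

Lemma weighted_iter_fdiff n f h : continuous f -> weighted 0 f ->
  weighted n (iter n (fdiff h) f).
Proof.
move=> cf Vf; suff [] : continuous (iter n (fdiff h) f) /\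
  weighted n (iter n (fdiff h) f) by [].
elim: n => // n [cn Vn]; split; first exact: fdiff_continuous.
exact: weighted_fdiff.
Qed.

(* V contains s^n as soon as some n-th difference of f does not vanish, and if all
   of them vanish then f is a polynomial. *)
Lemma dilation_closure_full f : continuous f ->
  ~ (exists p : {poly R}, forall t, f t = p.[t]) ->
  (forall t b, V (fun s => f (t * s + b))) ->
  forall g, continuous g -> V g.
Proof.
move=> cf npoly Vf.
have VZ c g : V g -> V (c *: g) by move=> Vg; rewrite -[_ *: _]addr0; exact: VP.
have Vmono n : V (fun s => s ^+ n).
  have [h [y hy]] : exists h y, iter n (fdiff h) f y != 0.
    apply: contrapT => nh; apply: npoly; apply: (Frechet_polynomial n) => // h y.
    by apply: contrapT => /eqP hy; apply: nh; exists h, y.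
  have Vf0 : weighted 0 f by move=> t b; under eq_fun do rewrite expr0 mul1r.
  (* At [t = 0] the dilate is constant in [s], which leaves a nonzero multiple of [s ^+ n]. *)
  have := weighted_iter_fdiff n f h cf Vf0 0 y.
  move=> /(VZ (iter n (fdiff h) f y)^-1); congr V; apply/funext => s.
  have -> (c : R) (u : R -> R) : (c *: u) s = c * u s by [].
  by rewrite mul0r add0r mulrCA mulVf ?mulr1.
have Vpoly (p : {poly R}) : V (horner p).
  have := closure_sum (size p) (fun j => p`_j) (fun j s => s ^+ j) (fun j => Vmono j).
  by congr V; apply/funext => s; rewrite fct_sumE horner_coef.
move=> g cg; apply: Vlim => // b e e0.
by have [p hp] := Weierstrass g b e cg e0; exists (horner p).
Qed.

End DilationClosure.

(** * Hahn-Banach *)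

Section HahnBanach.
Context {R : realType} {V : lmodType R}.
Implicit Types (p q : V -> R) (x y z : V).

(** Homogeneity is asked as an inequality for positive scalars, which is what infima satisfy
    directly; scaling back by the inverse gives equality. *)
Definition sublinear p :=
  [/\ forall x y, p (x + y) <= p x + p y,
      forall (c : R) x, 0 < c -> p (c *: x) <= c * p x & p 0 <= 0].

Lemma sublinear0 p : sublinear p -> p 0 = 0.
Proof.
move=> [pD _ p0]; apply/le_anti; rewrite p0 /=.
by have := pD 0 0; rewrite addr0; lra.
Qed.

Lemma sublinear_geN p x : sublinear p -> - p (- x) <= p x.
Proof.
move=> sp; have := sublinear0 _ sp; case: sp => pD _ _ p0.
by have := pD x (- x); rewrite subrr p0; lra.
Qed.

Lemma sublinearZ p (c : R) x : sublinear p -> 0 <= c -> p (c *: x) = c * p x.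
Proof.
move=> sp; rewrite le_eqVlt => /predU1P[<-|c0].
  by rewrite scale0r mul0r sublinear0.
case: sp => _ pZ _; apply/le_anti; rewrite pZ //=.
have := pZ c^-1 (c *: x); rewrite invr_gt0 => /(_ c0).
rewrite scalerA mulVf ?gt_eqF // scale1r => h.
by rewrite -ler_pdivlMl.
Qed.

(** Take [q x] to be the infimum of [p (x + t *: y) - t * p y] over [t >= 0]; [t = 0] and [t = 1]
    give the two bounds. The second one forces [q (- y) <= - p y], and makes a minimal functional
    superadditive. *)
Lemma sublinear_tilt p y : sublinear p -> exists q,
  [/\ sublinear q, forall x, q x <= p x & forall x, q x <= p (x + y) - p y].
Proof.
move=> sp.
pose A x := [set p (x + t *: y) - t * p y | t in [set t : R | 0 <= t]].
have Alb x : has_lbound (A x).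
  exists (- p (- x)) => _ [t /= t0 <-].
  have [pD _ _] := sp; have := pD (x + t *: y) (- x).
  by rewrite addrAC subrr add0r sublinearZ //; lra.
have Ane x : A x !=set0 by exists (p (x + 0 *: y) - 0 * p y), 0 => /=.
have qA x t : 0 <= t -> inf (A x) <= p (x + t *: y) - t * p y.
  by move=> t0; apply: ge_inf => //; exists t.
have [pD pZ p0] := sp.
exists (fun x => inf (A x)); split => [|x|x]; last 2 first.
- by have := qA x 0 (lexx _); rewrite scale0r addr0 mul0r subr0.
- by have := qA x 1 ler01; rewrite scale1r mul1r.
split.
- move=> x x'; rewrite -lerBlDr; apply: lb_le_inf => // _ [t /= t0 <-].
  rewrite lerBlDr -lerBlDl; apply: lb_le_inf => // _ [s /= s0 <-].
  rewrite lerBlDl; apply: le_trans (qA _ (t + s) (addr_ge0 t0 s0)) _.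
  by have := pD (x + t *: y) (x' + s *: y); rewrite addrACA -scalerDl; lra.
- move=> c x c0; rewrite -ler_pdivrMl //.
  apply: lb_le_inf => // _ [t /= t0 <-]; rewrite ler_pdivrMl //.
  apply: le_trans (qA _ (c * t) (mulr_ge0 (ltW c0) t0)) _.
  by rewrite -scalerA -scalerDr sublinearZ ?(ltW c0)// mulrBr mulrA.
- by apply: le_trans (qA 0 0 (lexx _)) _; rewrite scale0r addr0 mul0r subr0.
Qed.

Lemma exists_minimal_sublinear p : sublinear p -> exists q,
  [/\ sublinear q, forall x, q x <= p x
    & forall r, sublinear r -> (forall x, r x <= q x) -> r = q].
Proof.
move=> sp; pose T := {q : V -> R | sublinear q /\ forall x, q x <= p x}.
(* The order is reversed, so that a maximal element for Zorn is a minimal functional. *)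
pose le (s t : T) := `[< forall x, sval t x <= sval s x >].
have [||| |[q [sq qp]] qmin] := @Zorn T le.
- by move=> s; apply/asboolP => x.
- move=> r s t /asboolP rs /asboolP st; apply/asboolP => x.
  exact: le_trans (st x) (rs x).
- move=> [s ps] [t pt] /asboolP /= st /asboolP /= ts.
  apply: eq_exist => //=; apply/funext => x.
  by apply/le_anti; rewrite st ts.
- move=> A Atot; have [[s0 As0]|A0] := pselect (A !=set0); last first.
    exists (exist _ p (conj sp (fun x => lexx (p x))) : T) => s As.
    by exfalso; apply: A0; exists s.
  pose B x := [set sval s x | s in A].
  have Blb x : has_lbound (B x).
    exists (- p (- x)) => _ [[s [ss sp']] _ <-] /=.
    by apply: le_trans (sublinear_geN _ x ss); rewrite lerN2.
  have Bne x : B x !=set0 by exists (sval s0 x), s0.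
  have mA x s : A s -> inf (B x) <= sval s x.
    by move=> As; apply: ge_inf => //; exists s.
  have smin : sublinear (fun x => inf (B x)).
    split.
    - move=> x y; rewrite -lerBlDr; apply: lb_le_inf => // _ [s As <-].
      rewrite lerBlDr -lerBlDl; apply: lb_le_inf => // _ [t At <-].
      (* Subadditivity passes to the infimum because the chain is total: the smaller of [s] and [t]
         serves both [x] and [y]. *)
      rewrite lerBlDl; have [/asboolP st|/asboolP ts] := Atot _ _ As At.
        apply: le_trans (mA _ _ At) _; have [[+ _ _] _] := svalP t.
        by move=> /(_ x y) h; apply: le_trans h _; rewrite lerD2r.
      apply: le_trans (mA _ _ As) _; have [[+ _ _] _] := svalP s.
      by move=> /(_ x y) h; apply: le_trans h _; rewrite lerD2l.
    - move=> c x c0; rewrite -ler_pdivrMl //; apply: lb_le_inf => // _ [s As <-].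
      rewrite ler_pdivrMl //; apply: le_trans (mA _ _ As) _.
      by have [[_ + _] _] := svalP s; apply.
    - by apply: le_trans (mA _ _ As0) _; have [[_ _ +] _] := svalP s0; apply.
  have minp x : inf (B x) <= p x.
    by apply: le_trans (mA _ _ As0) _; have [_] := svalP s0; apply.
  exists (exist _ (fun x => inf (B x)) (conj smin minp) : T) => s As; apply/asboolP => x /=.
  exact: mA.
exists q; split => // r sr rq.
have rp x : r x <= p x by apply: le_trans (rq x) (qp x).
have := qmin (exist _ r (conj sr rp) : T).
by move=> /(_ (asboolT rq)) [].
Qed.

(* No partial extension is needed: a minimal sublinear functional is linear. *)
Lemma Hahn_Banach p y : sublinear p -> exists L : V -> R,
  [/\ forall a x z, L (a *: x + z) = a * L x + L z,
      forall x, L x <= p x & L y = p y].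
Proof.
(* Tilting by [y] before minimizing gives [L (- y) <= - p y], hence [L y = p y]. *)
move=> sp; have [p1 [sp1 p1p p1y]] := sublinear_tilt _ y sp.
have [L [sL Lp1 Lmin]] := exists_minimal_sublinear _ sp1.
have LD x z : L (x + z) = L x + L z.
  have [q [sq qL qz]] := sublinear_tilt _ z sL.
  have qE := Lmin _ sq qL; have [LD _ _] := sL.
  by apply/le_anti; rewrite LD /=; have := qz x; rewrite qE; lra.
have LN x : L (- x) = - L x.
  by have := LD x (- x); rewrite subrr sublinear0 //; lra.
exists L; split.
- move=> a x z; rewrite LD; congr (_ + _).
  have [a0|a0] := leP 0 a; first by rewrite sublinearZ.
  by rewrite -[a in LHS]opprK scaleNr LN sublinearZ ?oppr_ge0 ?ltW//; lra.
- by move=> x; apply: le_trans (Lp1 x) (p1p x).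
- apply/le_anti; rewrite (le_trans (Lp1 y) (p1p y)) /=.
  have := Lp1 (- y); have := p1y (- y).
  by rewrite LN addNr sublinear0 //; lra.
Qed.

End HahnBanach.

(** * Functionals of norm at most 1 on the continuous functions *)

Section ContinuousFunctionals.
Context {R : realType} {T : topologicalType}.

Definition cfun_pred : {pred T -> R} := mem [set f : T -> R | continuous f].

Fact cfun_submod : submod_closed cfun_pred.
Proof.
split; first by rewrite inE /=; exact: cst_continuous.
move=> a f g; rewrite !inE /= => cf cg x.
by apply: cvgD; [apply: cvgZl_tmp; exact: cf|exact: cg].
Qed.

HB.instance Definition _ :=
  GRing.isSubmodClosed.Build R (T -> R) cfun_pred cfun_submod.

Definition cfun := {f : T -> R | f \in cfun_pred}.

HB.instance Definition _ := [isSub of cfun for (@sval _ _)].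
HB.instance Definition _ := [Choice of cfun by <:].
HB.instance Definition _ := [SubChoice_isSubLmodule of cfun by <:].

(** [L] takes arbitrary functions but is constrained only on continuous ones, so later arguments
    need no subtype. *)
Definition contractive_functional (L : (T -> R) -> R) :=
  (forall a f g, continuous f -> continuous g ->
     L (a *: f + g) = a * L f + L g) /\
  (forall f M, 0 <= M -> continuous f -> (forall x, `|f x| <= M) ->
     `|L f| <= M).

Lemma continuous_bounded (f : T -> R) : compact [set: T] -> continuous f ->
  exists2 M, 0 <= M & forall x, `|f x| <= M.
Proof.
move=> cT cf; have cfT : compact (range f).
  by apply: continuous_compact => //; exact: continuous_subspaceT.
have [N [_ hN]] := compact_bounded cfT.
exists (`|N| + 1) => [|x]; first by rewrite addr_ge0.
by apply: hN; [rewrite ltr_pwDr ?ler_norm|exists x].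
Qed.

(** Apply Hahn-Banach to the uniform distance to [D], which is sublinear because [D] is a subspace.
    It vanishes on [D], is at most the uniform norm, and is at least [e] at [f0]. *)
Lemma separating_functional (D : set (T -> R)) (f0 : T -> R) (e : R) :
  compact [set: T] -> continuous f0 -> 0 < e ->
  D 0 -> (forall a f g, D f -> D g -> D (a *: f + g)) ->
  (forall g, D g -> continuous g) ->
  (forall g, D g -> ~ forall x, `|f0 x - g x| <= e) ->
  exists L, [/\ contractive_functional L, forall g, D g -> L g = 0 & L f0 != 0].
Proof.
move=> cT cf0 e0 D0 DP Dc far.
pose A (f : T -> R) : set R :=
  [set r | 0 <= r /\ exists2 g, D g & forall x, `|f x - g x| <= r].
have Alb f : has_lbound (A f) by exists 0 => r [].
have Ane (f : T -> R) : continuous f -> A f !=set0.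
  move=> cf; have [M M0 hM] := continuous_bounded _ cT cf.
  by exists M; split => //; exists 0 => // x; rewrite subr0.
have pA f r g : 0 <= r -> D g -> (forall x, `|f x - g x| <= r) -> inf (A f) <= r.
  by move=> r0 Dg h; apply: ge_inf => //; split => //; exists g.
have cfunP (v : cfun) : continuous (val v) by have := valP v; rewrite inE.
pose p (v : cfun) := inf (A (val v)).
have sp : sublinear p.
  split.
  - move=> v w; rewrite -lerBlDr; apply: lb_le_inf; first exact: Ane.
    move=> r [r0 [g Dg hg]]; rewrite lerBlDr -lerBlDl.
    apply: lb_le_inf; first exact: Ane.
    move=> s [s0 [h Dh hh]]; rewrite lerBlDl.
    apply: (pA _ _ (1 *: g + h)); [exact: addr_ge0|exact: DP|move=> x].
    have -> : val (v + w) x - (1 *: g + h) x =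
        (val v x - g x) + (val w x - h x).
      by rewrite !fctE scale1r opprD addrACA.
    by apply: le_trans (ler_normD _ _) _; exact: lerD.
  - move=> c v c0; rewrite -ler_pdivrMl //; apply: lb_le_inf; first exact: Ane.
    move=> r [r0 [g Dg hg]]; rewrite ler_pdivrMl //.
    apply: (pA _ _ (c *: g + 0)); [by rewrite mulr_ge0 // ltW|exact: DP|].
    move=> x; rewrite addr0.
    have -> : val (c *: v) x - (c *: g) x = c * (val v x - g x).
      by rewrite !fctE mulrBr.
    by rewrite normrM gtr0_norm // ler_pM2l.
  - by apply: (pA _ _ 0) => // x; rewrite subrr normr0.
have mkP (f : T -> R) : continuous f -> f \in cfun_pred by rewrite inE.
pose F0 : cfun := Sub f0 (mkP _ cf0).
have [L [Llin Lp LF0]] := Hahn_Banach _ F0 sp.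
have mkE (f : T -> R) (cf : continuous f) : insubd F0 f = Sub f (mkP _ cf).
  by apply: val_inj; rewrite insubdK ?SubK //; exact: (mkP _ cf).
(* On a discontinuous [f], [insubd] returns the default [F0]. *)
exists (fun f => L (insubd F0 f)); split.
- split => [a f g cf cg|f M M0 cf hM].
    rewrite -Llin; congr L; apply: val_inj.
    rewrite [RHS](_ : _ = a *: val (insubd F0 f) + val (insubd F0 g)) //.
    rewrite !insubdK // inE => // x; apply: cvgD; [apply: cvgZl_tmp; exact: cf|exact: cg].
  have L0 : L 0 = 0 by have := Llin 1 0 0; rewrite scaler0 addr0; lra.
  have LN v : L (- v) = - L v.
    by have := Llin (-1) v 0; rewrite addr0 L0 scaleN1r; lra.
  rewrite ler_norml; apply/andP; split; last first.
    by apply: le_trans (Lp _) _; apply: (pA _ _ 0) => // x; rewrite mkE subr0.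
  rewrite lerNl -LN; apply: le_trans (Lp _) _; apply: (pA _ _ 0) => // x.
  by rewrite mkE subr0 (_ : val _ x = - f x) ?normrN.
- move=> g Dg; have cg := Dc _ Dg.
  have L0 : L 0 = 0 by have := Llin 1 0 0; rewrite scaler0 addr0; lra.
  have LN v : L (- v) = - L v.
    by have := Llin (-1) v 0; rewrite addr0 L0 scaleN1r; lra.
  apply/le_anti; rewrite mkE; apply/andP; split.
    by apply: le_trans (Lp _) _; apply: (pA _ _ g) => // x; rewrite subrr normr0.
  rewrite -oppr_le0 -LN; apply: le_trans (Lp _) _.
  apply: (pA _ _ (-1 *: g + 0)) => //; first exact: DP.
  by move=> x; rewrite addr0 scaleN1r (_ : val _ x = - g x) ?subrr ?normr0.
- rewrite mkE -/F0 LF0 gt_eqF //; apply: lt_le_trans e0 _.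
  apply: lb_le_inf => [|r [r0 [g Dg hg]]]; first exact: Ane.
  rewrite leNgt; apply/negP => re; apply: (far g Dg) => x.
  exact: le_trans (hg x) (ltW re).
Qed.

End ContinuousFunctionals.

(** * The variation of a functional on open sets *)

Section Clip.
Context {R : realType}.

Definition clip (c y : R) : R := Num.max (- c) (Num.min c y).

Lemma clip_spec (c y : R) : 0 <= c ->
  [\/ c <= y /\ clip c y = c, y <= - c /\ clip c y = - c
    | - c <= y <= c /\ clip c y = y].
Proof.
move=> c0; rewrite /clip; have [cy|yc] := leP c y.
  by constructor 1; split => //; rewrite max_r //; lra.
have [h|h] := leP (- c) y.
  by constructor 3; split => //; rewrite ltW.
by constructor 2; split => //; exact: ltW.
Qed.

Lemma clip_norm (c y : R) : 0 <= c -> `|clip c y| <= c.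
Proof. by move=> c0; rewrite ler_norml; case: (clip_spec c y c0) => -[h ->]; lra. Qed.

Lemma clip_id (c y : R) : 0 <= c -> `|y| <= c -> clip c y = y.
Proof. by move=> c0; rewrite ler_norml; case: (clip_spec c y c0) => -[h ->]; lra. Qed.

Lemma clip_res (c b y : R) : 0 <= c -> 0 <= b -> `|y| <= c + b ->
  `|y - clip c y| <= b.
Proof.
by move=> c0 b0; rewrite !ler_norml; case: (clip_spec c y c0) => -[h ->]; lra.
Qed.

Lemma clip_continuous (T : topologicalType) (c : R) (f : T -> R) :
  continuous f -> continuous (fun x => clip c (f x)).
Proof.
move=> cf x; apply: (@continuous_max R T (cst (- c)) (fun x => Num.min c (f x))).
  exact: cst_continuous.
by apply: (@continuous_min R T (cst c) f); [exact: cst_continuous|exact: cf].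
Qed.

End Clip.

Section VariationMass.
Context {R : realType} {T : topologicalType} (L : (T -> R) -> R).
Hypotheses (cT : compact [set: T]) (hT : hausdorff_space T).
Hypothesis cL : contractive_functional L.
Implicit Types (f g h : T -> R) (U V W E : set T) (c e : R).

Lemma functionalD f g : continuous f -> continuous g -> L (f + g) = L f + L g.
Proof.
by move=> cf cg; have := cL.1 1 f g cf cg; rewrite scale1r mul1r.
Qed.

Let continuous0 : continuous (0 : T -> R).
Proof. exact: cst_continuous. Qed.

Lemma functional0 : L 0 = 0.
Proof.
have := functionalD 0 0 continuous0 continuous0.
by rewrite addr0; lra.
Qed.

Lemma functionalZ c f : continuous f -> L (c *: f) = c * L f.
Proof.
move=> cf; have := cL.1 c f 0 cf continuous0.
by rewrite !addr0 functional0 addr0.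
Qed.

Lemma functionalB f g : continuous f -> continuous g -> L (f - g) = L f - L g.
Proof.
move=> cf cg; rewrite -scaleN1r addrC; have := cL.1 (-1) g f cg cf => ->.
by rewrite mulN1r addrC.
Qed.

(** Only vanishing off [U] is asked, not compact support in [U]; [trunc] recovers a closed set
    inside [U] when one is needed. *)
Definition carried U f :=
  [/\ continuous f, forall x, `|f x| <= 1 & forall x, ~ U x -> f x = 0].

Definition mass U := sup [set L f | f in carried U].

Lemma carried0 U : carried U 0.
Proof. by split => // x; rewrite normr0. Qed.

Lemma has_sup_mass U : has_sup [set L f | f in carried U].
Proof.
split; first by exists (L 0), 0 => //; exact: carried0.
exists 1 => _ [f [cf f1 _] <-].
by apply: le_trans (ler_norm _) _; exact: cL.2.
Qed.

Lemma mass_ub U f : carried U f -> L f <= mass U.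
Proof. by move=> Uf; apply: ub_le_sup; [case: (has_sup_mass U)|exists f]. Qed.

Lemma mass_ge0 U : 0 <= mass U.
Proof. by rewrite -functional0; apply: mass_ub; exact: carried0. Qed.

Lemma mass_approx U e : 0 < e -> exists2 f, carried U f & mass U - e < L f.
Proof.
move=> e0; have [_ [f Uf <-] h] := sup_adherent e0 (has_sup_mass U).
by exists f.
Qed.

Lemma mass_leP U c :
  (forall f, carried U f -> L f <= c) -> mass U <= c.
Proof.
move=> h; apply: ge_sup; first by case: (has_sup_mass U).
by move=> _ [f Uf <-]; exact: h.
Qed.

Lemma mass_mono U V : U `<=` V -> mass U <= mass V.
Proof.
move=> UV; apply: mass_leP => f [cf f1 f0]; apply: mass_ub; split => // x nV.
by apply: f0 => /UV.
Qed.

Lemma mass0 : mass set0 = 0.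
Proof.
apply/le_anti; rewrite mass_ge0 andbT; apply: mass_leP => f [cf f1 f0].
by rewrite (_ : f = 0) ?functional0 //; apply/funext => x; exact: f0.
Qed.

Lemma mass_scale U c f : 0 <= c -> continuous f -> (forall x, `|f x| <= c) ->
  (forall x, ~ U x -> f x = 0) -> L f <= c * mass U.
Proof.
move=> c0 cf fc f0; move: c0; rewrite le_eqVlt => /predU1P[c0|c0].
  rewrite -c0 mul0r; apply: le_trans (ler_norm _) _; apply: cL.2 => //.
  by rewrite c0.
have cf' : continuous (c^-1 *: f) by move=> x; apply: cvgZl_tmp; exact: cf.
rewrite -ler_pdivrMl // -functionalZ //; apply: mass_ub; split => //.
  move=> x; rewrite fctE /= normrM gtr0_norm ?invr_gt0 //.
  by rewrite ler_pdivrMl // mulr1.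
by move=> x /f0 fx; rewrite fctE /= fx scaler0.
Qed.

(** Soft thresholding: for [c >= 0] it moves [f] by at most [c] and kills it wherever its absolute
    value is at most [c]. *)
Definition trunc c f : T -> R := fun x => f x - clip c (f x).

Lemma trunc_continuous f c : continuous f -> continuous (trunc c f).
Proof. by move=> cf x; apply: cvgB; [exact: cf|exact: clip_continuous]. Qed.

Lemma trunc_dist f c : 0 <= c -> continuous f ->
  L f <= L (trunc c f) + c.
Proof.
move=> c0 cf; have cc := clip_continuous _ c _ cf.
rewrite [trunc c f](_ : _ = f - (fun x => clip c (f x))) // functionalB //.
suff : `|L (fun x => clip c (f x))| <= c by rewrite ler_norml; lra.
by apply: cL.2 => // x; exact: clip_norm.
Qed.

(* Cut f + g at height 1: the truncation is carried by the union, and the excess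
   only lives where neither f nor g vanishes. *)
Lemma mass_modular U V : mass U + mass V <= mass (U `|` V) + mass (U `&` V).
Proof.
apply/ler_addgt0Pr => e e0; have e20 : 0 < e / 2 by rewrite divr_gt0.
have [f [cf f1 f0] Lf] := mass_approx U _ e20.
have [g [cg g1 g0] Lg] := mass_approx V _ e20.
have cfg : continuous (f + g) by move=> x; apply: cvgD; [exact: cf|exact: cg].
pose h x := clip 1 ((f + g) x).
have ch : continuous h by exact: clip_continuous.
have Lh : L h <= mass (U `|` V).
  apply: mass_ub; split => // [x|x UVx]; first exact: clip_norm.
  have fx : f x = 0 by apply: f0 => Ux; apply: UVx; left.
  have gx : g x = 0 by apply: g0 => Vx; apply: UVx; right.
  by rewrite /h fctE fx gx addr0 clip_id ?normr0.
have Lr : L ((f + g) - h) <= mass (U `&` V).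
  apply: mass_ub; split.
  - exact: (trunc_continuous (f + g) 1).
  - move=> x; rewrite fctE; apply: clip_res => //.
    by apply: le_trans (ler_normD _ _) _; exact: lerD.
  - move=> x UVx; rewrite (_ : (f + g - h) x = (f + g) x - clip 1 ((f + g) x)) //.
    rewrite clip_id ?subrr // fctE.
    have [Ux|Ux] := pselect (U x); last by rewrite f0 // add0r.
    by rewrite g0 ?addr0 // => Vx; exact: UVx.
by move: Lr; rewrite functionalB // functionalD //; lra.
Qed.

Lemma Urysohn_fun (A B : set T) : closed A -> closed B -> A `&` B = set0 ->
  exists f : T -> R, [/\ continuous f, forall x, 0 <= f x <= 1,
    forall x, A x -> f x = 0 & forall x, B x -> f x = 1].
Proof.
move=> clA clB AB0.
have /(@normal_separatorP R) nT : normal_space T by exact: compact_normal.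
have /(@uniform_separatorP _ R) [f [cf f01 fA fB]] := nT _ _ clA clB AB0.
exists f; split => // x; last 2 first.
- by move=> Ax; apply: fA; exists x.
- by move=> Ax; apply: fB; exists x.
by have /= := f01 (f x) (ex_intro2 _ _ x I erefl); rewrite in_itv.
Qed.

Lemma closed_norm_ge f c : continuous f -> closed [set x | c <= `|f x|].
Proof.
move=> cf; apply: (@preimage_closed _ _ (fun x => `|f x|) [set y | c <= y]).
  by move=> x _; apply: cvg_norm; exact: cf.
exact: closed_ge.
Qed.

Lemma open_norm_lt f c : continuous f -> open [set x | `|f x| < c].
Proof.
move=> cf; apply: (@open_comp _ _ (fun x => `|f x|) [set y | y < c]).
  by move=> x _; apply: cvg_norm; exact: cf.
exact: open_lt.
Qed.

(** After truncation, [g] lives on a closed subset [S] of the union. A Urysohn function [phi], 0 off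
    [U] and 1 on the part of [S] outside [V], splits [g] into [g * phi], carried by [U], and the
    rest, carried by [V]. *)
Lemma mass_setU U V : open U -> open V -> mass (U `|` V) <= mass U + mass V.
Proof.
move=> oU oV; apply: mass_leP => f [cf f1 f0]; apply/ler_addgt0Pr => c c0.
apply: le_trans (trunc_dist f c (ltW c0) cf) _; rewrite lerD2r.
set g := trunc c f; have cg : continuous g by exact: trunc_continuous.
pose S := [set x | c <= `|f x|].
have gS x : ~ S x -> g x = 0.
  by move=> /negP; rewrite -ltNge => /ltW fc; rewrite /g /trunc clip_id ?subrr ?(ltW c0).
have g1 x : `|g x| <= 1.
  by apply: clip_res => //; [exact: ltW|have := f1 x; lra].
have [|||phi [cphi phi01 phi0 phi1]] := @Urysohn_fun (~` U) (S `&` ~` V).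
- exact: open_closedC.
- by apply: closedI; [exact: closed_norm_ge|exact: open_closedC].
- rewrite -subset0 => x [nU [+ nV]]; rewrite /S /= f0 ?normr0; first by lra.
  by case.
have cgp : continuous (g * phi).
  by move=> x; apply: cvgM; [exact: cg|exact: cphi].
have cgp' : continuous (g - g * phi).
  by move=> x; apply: cvgB; [exact: cg|exact: cgp].
rewrite [g in L g](_ : _ = g * phi + (g - g * phi)); last first.
  by rewrite addrC subrK.
rewrite functionalD //; apply: lerD; apply: mass_ub; split => // x.
- have := phi01 x; have := g1 x; rewrite fctE normrM => ? ?.
  rewrite [`|phi x|]ger0_norm; last by lra.
  by apply: mulr_ile1 => //; lra.
- by move=> nU; rewrite fctE phi0 // mulr0.
- have := phi01 x; have := g1 x; rewrite !fctE -[X in X - _]mulr1 -mulrBr normrM.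
  move=> ? ?; rewrite [`|1 - phi x|]ger0_norm; last by lra.
  by apply: mulr_ile1 => //; lra.
- move=> nV; rewrite !fctE; have [Sx|/gS ->] := pselect (S x); last by lra.
  by rewrite phi1 // mulr1 subrr.
Qed.

(** For [f] nearly optimal on [U], let [E] be the set where its absolute value is at least [e / 2].
    Truncation shows that [O], the set of strict inequality, has mass at least [mass U - e]; being
    disjoint from the remainder of [U], it leaves at most [e] there by [mass_modular]. *)
Lemma mass_inner U e : 0 < e -> exists E,
  [/\ closed E, E `<=` U & mass (U `\` E) <= e].
Proof.
move=> e0; have e20 : 0 < e / 2 by rewrite divr_gt0.
have [f [cf f1 f0] Lf] := mass_approx U _ e20.
exists [set x | e / 2 <= `|f x|]; split.
- exact: closed_norm_ge.
- move=> x /= fx; apply: contrapT => /f0 fx0; move: fx.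
  by rewrite fx0 normr0; lra.
pose O := [set x | e / 2 < `|f x|].
have LO : mass U - e <= mass O.
  have tO : carried O (trunc (e / 2) f).
    split; first exact: trunc_continuous.
    - move=> x; apply: clip_res; [exact: ltW|exact: ler01|].
      by have := f1 x; lra.
    - move=> x /negP; rewrite -leNgt => h.
      by rewrite /trunc clip_id ?subrr // ltW.
  by have := mass_ub _ _ tO; have := trunc_dist f (e / 2) (ltW e20) cf; lra.
have := mass_modular (U `\` [set x | e / 2 <= `|f x|]) O.
have : mass (U `\` [set x | e / 2 <= `|f x|] `|` O) <= mass U.
  apply: mass_mono => x [[]//|/= Ox]; apply: contrapT => /f0 fx; move: Ox.
  by rewrite /O /= fx normr0; lra.
rewrite (_ : _ `&` O = set0); last first.
  by rewrite -subset0 => x [[_ /= nx] /ltW].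
by rewrite mass0; lra.
Qed.

Lemma mass_bigcup (U : nat -> set T) n : (forall i, open (U i)) ->
  mass (\bigcup_(i < n) U i) <= \sum_(i < n) mass (U i).
Proof.
move=> oU; elim: n => [|n IH].
  by rewrite bigcup_mkord !big_ord0 mass0.
rewrite bigcup_mkord !big_ord_recr /= -bigcup_mkord.
apply: le_trans (mass_setU _ _ _ (oU n)) _; first exact: bigcup_open.
by rewrite lerD2r.
Qed.

Lemma sum_halves_le e n : 0 <= e -> \sum_(i < n) e / 2 ^+ i.+1 <= e.
Proof.
move=> e0; suff -> : \sum_(i < n) e / 2 ^+ i.+1 = e - e / 2 ^+ n.
  by rewrite lerBlDr lerDl divr_ge0 // exprn_ge0.
elim: n => [|n IH]; first by rewrite big_ord0 expr0 divr1 subrr.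
rewrite big_ord_recr /= IH exprS invfM.
by lra.
Qed.

Lemma mass_bigcup_halves (U : nat -> set T) n e : 0 <= e ->
  (forall i, open (U i)) -> (forall i, mass (U i) <= e / 2 ^+ i.+1) ->
  mass (\bigcup_(i < n) U i) <= e.
Proof.
move=> e0 oU hU; apply: le_trans (mass_bigcup U n oU) _.
by apply: le_trans (sum_halves_le e n e0); exact: ler_sum.
Qed.

Lemma closed_cover_nat E (U : nat -> set T) : closed E ->
  (forall i, open (U i)) -> E `<=` \bigcup_i U i ->
  exists n, E `<=` \bigcup_(i < n) U i.
Proof.
move=> clE oU EU; have : compact E by exact: (subclosed_compact clE cT).
move=> /compact_near_coveringP /(_ nat \oo (fun n => \bigcup_(i < n) U i)).
case=> [x Ex|N _ hN]; last by exists N => x; exact: (hN N (leqnn N)).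
have [i _ Ux] := EU x Ex; exists (U i, [set n | (i < n)%N]) => /=.
  by split; [exact: open_nbhs_nbhs|exists i.+1].
by move=> [y n] /= [Uy ni]; exists i.
Qed.

Lemma image_closed (p : T -> R) E : continuous p -> closed E -> closed (p @` E).
Proof.
move=> cp clE; apply: compact_closed; first exact: Rhausdorff.
apply: continuous_compact; first exact: continuous_subspaceT.
exact: (subclosed_compact clE cT).
Qed.

(** On the compact set [E] an injective continuous [p] is a closed map, so [f] composed with its
    inverse is continuous on the image; Tietze extends it to the line with the same bound. *)
Lemma factor_through (p f : T -> R) E : closed E -> continuous p ->
  {in E &, injective p} -> continuous f -> (forall x, `|f x| <= 1) ->
  exists g : R -> R, [/\ continuous g, forall y, `|g y| <= 1
    & forall x, E x -> g (p x) = f x].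
Proof.
move=> clE cp pI cf f1.
have [g0 hg0] : exists g0 : R -> R, forall x, E x -> g0 (p x) = f x.
  have /choice [g hg] : forall y, exists v, forall x, E x -> p x = y -> v = f x.
    move=> y; have [[x [Ex xy]]|nx] := pselect (exists x, E x /\ p x = y).
      exists (f x) => x' Ex' x'y; congr f.
      by apply: pI; rewrite ?inE // xy x'y.
    by exists 0 => x Ex xy; exfalso; apply: nx; exists x.
  by exists g => x Ex; exact: hg.
have cg0 : {within p @` E, continuous g0}.
  apply/continuous_closedP => C clC; apply/closed_subspaceP.
  exists (p @` (E `&` f @^-1` C)).
    apply: image_closed => //; apply: closedI => //.
    by apply: preimage_closed => // x _; exact: cf.
  apply/seteqP; split => [y [[x [Ex Cx] xy] py]|y [Cx [x Ex xy]]].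
    by split => //; rewrite /preimage /= -xy /from_subspace hg0.
  rewrite -xy in Cx *; split; last by exists x.
  by exists x => //; split => //; rewrite /= -hg0 //.
have [|||g [gE cg g1]] := @continuous_bounded_extension R R _ (p @` E) _ g0 1 ltr01 cg0.
- exact: pseudometric_normal.
- exact: image_closed.
- by move=> _ [x Ex <-]; rewrite hg0.
exists g; split => // x Ex; rewrite -gE ?hg0 //; rewrite inE.
by exists x.
Qed.

(** * Points that are alone in their fiber *)

Section UniqueFibers.
Variables (p : T -> R) (d : T * T -> R).
Hypotheses (cp : continuous p) (cd : continuous d).
Hypothesis d0 : forall x y, d (x, y) = 0 <-> x = y.
Hypothesis Lp : forall g : R -> R, continuous g -> L (g \o p) = 0.

(** Bounding [d] from below by [c] is a closed condition, unlike [y <> x]; the set is then the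
    projection of a compact subset of [T * T]. *)
Lemma closed_far_fiber K c : closed K -> closed
  [set x | K x /\ exists y, [/\ K y, p y = p x & c <= `|d (x, y)|]].
Proof.
move=> clK; pose S := [set z : T * T |
  (K z.1 /\ K z.2) /\ (p z.2 - p z.1 = 0 /\ c <= `|d z|)].
have cfst : continuous (@fst T T) by move=> ?; exact: cvg_fst.
have csnd : continuous (@snd T T) by move=> ?; exact: cvg_snd.
rewrite [X in closed X](_ : _ = fst @` S); last first.
  apply/seteqP; split => [x [Kx [y [Ky pxy xy]]]|_ [[x y] /= [[Kx Ky] [pxy xy]] <-]].
    by exists (x, y) => //; split => //=; rewrite pxy subrr.
  by split => //; exists y; split => //; exact/subr0_eq.
apply: compact_closed => //; apply: continuous_compact.
  exact: continuous_subspaceT.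
have cTT : compact [set: T * T] by rewrite -setXTT; exact: compact_setX.
apply: (subclosed_compact _ cTT) => //.
have cl1 : closed (@fst T T @^-1` K) by exact: preimage_closed.
have cl2 : closed (@snd T T @^-1` K) by exact: preimage_closed.
have cl3 : closed ((fun z : T * T => p z.2 - p z.1) @^-1` [set 0]).
  apply: preimage_closed; last exact: closed_eq.
  move=> z _; apply: cvgB.
    by apply: continuous_comp; [exact: csnd|exact: cp].
  by apply: continuous_comp; [exact: cfst|exact: cp].
have cl4 : closed ((fun z : T * T => `|d z|) @^-1` [set r | c <= r]).
  by apply: preimage_closed; [move=> z _; apply: cvg_norm; exact: cd|exact: closed_ge].
exact: closedI (closedI cl1 cl2) (closedI cl3 cl4).
Qed.

(* Choose O around E nearly optimal and f carried by O with L f close to mass O.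
   On E, f = g o p; subtracting (g chi) o p, with chi o p a cutoff around E,
   leaves L f unchanged and makes f vanish on E, so that L f is bounded by the
   masses of O minus E and of the complement of K, both small. *)
Lemma mass_unique_fiber_closed K E e : 0 < e -> closed K -> mass (~` K) <= e ->
  closed E -> E `<=` K -> (forall x y, E x -> K y -> p y = p x -> y = x) ->
  exists O, [/\ open O, E `<=` O & mass O < 7 * e].
Proof.
move=> e0 clK mK clE EK Einj.
pose A := [set mass O | O in [set O | open O /\ E `<=` O]].
have hA : has_inf A.
  split; first by exists (mass setT), setT => //; split => //; exact: openT.
  by exists 0 => _ [ O _ <-]; exact: mass_ge0.
have [_ [ O [oO EO] <-] Oinf] := inf_adherent e0 hA.
have Omin O' : open O' -> E `<=` O' -> mass O < mass O' + e.
  move=> oO' EO'; apply: lt_le_trans Oinf _; rewrite lerD2r.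
  by apply: ge_inf; [case: hA|exists O'].
exists O; split => //; rewrite ltNge; apply/negP => mO.
have [f [cf f1 f0] Lf] := mass_approx O e e0.
have pI : {in E &, injective p}.
  by move=> x y; rewrite !inE => Ex Ey pxy; apply: (Einj y x) => //; exact: EK.
have [g [cg g1 gf]] := factor_through _ _ _ clE cp pI cf f1.
(* The two images under [p] are disjoint because a point of [E] is alone in its fiber within [K]. *)
have [chi [cchi chi01 chi0 chi1]] :
    exists chi : R -> R, [/\ continuous chi, forall y, 0 <= chi y <= 1,
    forall y, (p @` (K `&` ~` O)) y -> chi y = 0
    & forall y, (p @` E) y -> chi y = 1].
  have /(@normal_separatorP R) nR : @normal_space R by exact: pseudometric_normal.
  have /(@uniform_separatorP _ R) [chi [cchi chi01 chiA chiB]] :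
      uniform_separator (p @` (K `&` ~` O)) (p @` E).
    apply: nR.
    - by apply: image_closed => //; apply: closedI => //; exact: open_closedC.
    - exact: image_closed.
    - rewrite -subset0 => _ [[y [Ky nOy] <-] [x Ex xy]].
      by apply: nOy; rewrite (Einj x y) //; exact: EO.
  exists chi; split => // y; last 2 first.
  - by move=> Ay; apply: chiA; exists y.
  - by move=> Ay; apply: chiB; exists y.
  by have /= := chi01 (chi y) (ex_intro2 _ _ y I erefl); rewrite in_itv.
pose k : R -> R := g * chi.
have ck : continuous k by move=> y; apply: cvgM; [exact: cg|exact: cchi].
have k1 y : `|k y| <= 1.
  rewrite /k fctE normrM; have := chi01 y; have := g1 y => ? ?.
  rewrite [`|chi y|]ger0_norm; last by lra.
  by apply: mulr_ile1 => //; lra.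
have ckp : continuous (k \o p).
  by move=> x; apply: continuous_comp; [exact: cp|exact: ck].
pose h := f - (k \o p).
have ch : continuous h by move=> x; apply: cvgB; [exact: cf|exact: ckp].
have Lh : L h = L f by rewrite functionalB // Lp // subr0.
have hxE x : h x = f x - g (p x) * chi (p x) by [].
have hE x : E x -> h x = 0.
  move=> Ex; have px : (p @` E) (p x) by exists x.
  by rewrite hxE gf // chi1 // mulr1 subrr.
have h0 x : ~ (O `|` ~` K) x -> h x = 0.
  move=> nx; have nO : ~ O x by move=> Ox; apply: nx; left.
  have Kx : K x by apply: contrapT => nK; apply: nx; right.
  have px : (p @` (K `&` ~` O)) (p x) by exists x.
  by rewrite hxE f0 // chi0 // mulr0 subrr.
pose V := (O `|` ~` K) `&` [set x | e < `|h x|].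
pose O1 := O `&` [set x | `|h x| < e].
have oO1 : open O1 by apply: openI => //; exact: open_norm_lt.
have EO1 : E `<=` O1.
  by move=> x Ex; split; [exact: EO|rewrite /= hE // normr0].
(* [O1] still surrounds [E], so its mass is within [e] of that of [O]. As [V] is disjoint from [O1]
   inside the union of [O] and the complement of [K], only [2 * e] remains for it. *)
have mV : mass V <= 2 * e.
  have := mass_modular V O1; rewrite (_ : V `&` O1 = set0); last first.
    by rewrite -subset0 => x [[_ /= ?] [_ /= ?]]; lra.
  have : mass (V `|` O1) <= mass (O `|` ~` K).
    by apply: mass_mono => x [[//]|[Ox _]]; left.
  have := mass_setU O (~` K) oO (closed_openC clK).
  by have := Omin _ oO1 EO1; rewrite mass0; lra.
(* The final count: [L f <= 2 * mass V + e <= 5 * e], whereas [L f > mass O - e >= 6 * e]. *)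
have := trunc_dist h e (ltW e0) ch; rewrite Lh.
have : L (trunc e h) <= 2 * mass V.
  apply: mass_scale => //.
  - exact: trunc_continuous.
  - move=> x; apply: clip_res; [exact: ltW|lra|].
    apply: le_trans (ler_normB _ _) _; have := f1 x; have := k1 (p x).
    by rewrite /=; lra.
  - move=> x nV; rewrite /trunc clip_id ?subrr ?(ltW e0) //.
    have [Ux|/h0 ->] := pselect ((O `|` ~` K) x); last by rewrite normr0 ltW.
    by rewrite leNgt; apply/negP => hx; apply: nV; split.
by lra.
Qed.

(* The points of K that are alone in their fiber form a countable intersection of
   relatively open sets, which is exhausted by closed sets up to small mass. *)
Lemma mass_unique_fiber K e : 0 < e -> closed K -> mass (~` K) <= e ->
  exists W, [/\ open W, ~` K `<=` W,
    forall x, K x -> (forall y, K y -> p y = p x -> y = x) -> W x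
    & mass W < 9 * e].
Proof.
move=> e0 clK mK.
pose C n := [set x | K x /\
  exists y, [/\ K y, p y = p x & n.+1%:R^-1 <= `|d (x, y)|]].
have clC n : closed (C n) by exact: closed_far_fiber.
have oW n : open (~` C n) by exact: closed_openC.
have Cmono m n : (m <= n)%N -> C m `<=` C n.
  move=> mn x [Kx [y [Ky pxy xy]]]; split => //; exists y; split => //.
  by apply: le_trans xy; rewrite lef_pV2 ?posrE // ler_nat.
have /choice [E hE] : forall n, exists E, [/\ closed E, E `<=` ~` C n
    & mass (~` C n `\` E) <= e / 2 ^+ n.+1].
  by move=> n; apply: mass_inner; rewrite divr_gt0 // exprn_gt0.
have oWE n : open (~` C n `\` E n).
  by have [clE _ _] := hE n; apply: openI => //; exact: closed_openC.
have clEI : closed (K `&` \bigcap_n E n).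
  by apply: closedI => //; apply: closed_bigI => n _; case: (hE n).
have [x y [Kx Ex] Ky pxy|O [oO EO mO]] := mass_unique_fiber_closed
    K _ e e0 clK mK clEI (@subIsetl _ _ _).
  apply: contrapT => xy.
  have dxy : 0 < `|d (x, y)|.
    by rewrite normr_gt0; apply/eqP => /d0 /esym.
  have [n _ hn] := near_infty_natSinv_lt (PosNum dxy).
  have [_ /(_ x (Ex n I)) nC _] := hE n; apply: nC; split => //.
  by exists y; split => //; apply/ltW/(hn n) => /=.
have oOK : open (O `|` ~` K) by apply: openU => //; exact: closed_openC.
(* What lies outside [O] and inside [K] is compact and misses the intersection of the [E n], so
   finitely many complements of them cover it. *)
have [|||n hn] := closed_cover_nat (~` (O `|` ~` K)) (fun n => ~` E n).
- exact: open_closedC.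
- by move=> i; apply: closed_openC; case: (hE i).
- move=> x nx; apply: contrapT => nE; apply: nx.
  have [Kx|] := pselect (K x); last by right.
  left; apply: EO; split => // i _; apply: contrapT => nEi.
  by apply: nE; exists i.
exists (~` C n); split => //.
- by move=> x nK [].
- move=> x Kx ux [_ [y [Ky pxy]]]; rewrite (ux y Ky pxy) (d0 x x).2 // normr0.
  by rewrite leNgt invr_gt0 ltr0n.
(* The pieces have mass below [7 * e], at most [e] for the complement of [K], and at most [e] for
   the union of the remainders, whence [9 * e]. *)
have : mass (~` C n) <= mass ((O `|` ~` K) `|` \bigcup_(i < n) (~` C i `\` E i)).
  apply: mass_mono => x nC; have [|/hn [i ni nE]] := pselect ((O `|` ~` K) x).
    by left.
  right; exists i => //; split => // /(Cmono i n (ltnW ni)).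
  exact: nC.
have := mass_setU (O `|` ~` K) (\bigcup_(i < n) (~` C i `\` E i)) oOK.
have := mass_setU O (~` K) oO (closed_openC clK).
have := mass_bigcup_halves (fun i => ~` C i `\` E i) n e (ltW e0) oWE.
move=> /(_ (fun i => let: And3 _ _ h := hE i in h)) h1 h2.
by move=> /(_ (bigcup_open (fun i _ => oWE i))) h3 h4; lra.
Qed.

(** Null in the outer sense: an arbitrary [N] is measured through its open neighborhoods. *)
Definition mass_null N := forall e, 0 < e ->
  exists U, [/\ open U, N `<=` U & mass U < e].

(** Shrink [Z] to the closed complement of a small open neighborhood of its complement. A point of
    the smaller set that was alone in its fiber within [Z] stays alone there. *)
Lemma mass_null_unique_fiber Z : mass_null (~` Z) ->
  mass_null (~` Z `|` [set x | forall y, Z y -> p y = p x -> y = x]).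
Proof.
move=> nZ e e0; have e10 : 0 < e / 10 by rewrite divr_gt0.
have [U [oU ZU mU]] := nZ _ e10.
have UZ : ~` U `<=` Z by rewrite -[Z]setCK; exact: subsetC.
have [|W [oW UW uW mW]] := mass_unique_fiber (~` U) _ e10 (open_closedC oU).
  by rewrite setCK ltW.
rewrite setCK in UW; exists W; split => //; last by lra.
move=> x [/ZU /UW //|ux]; have [/UW//|nU] := pselect (U x).
by apply: uW => // y Uy; apply: ux; exact: UZ.
Qed.

End UniqueFibers.

Lemma mass_null_sub N N' : N `<=` N' -> mass_null N' -> mass_null N.
Proof.
move=> NN' nN e e0; have [U [oU NU mU]] := nN e e0.
by exists U; split => //; exact: subset_trans NU.
Qed.

Lemma mass_null0 : mass_null set0.
Proof. by move=> e e0; exists set0; split => //; [exact: open0|rewrite mass0]. Qed.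

Lemma mass_null_setU N N' : mass_null N -> mass_null N' -> mass_null (N `|` N').
Proof.
move=> nN nN' e e0; have e20 : 0 < e / 2 by rewrite divr_gt0.
have [U [oU NU mU]] := nN _ e20; have [V [oV NV mV]] := nN' _ e20.
exists (U `|` V); split; [exact: openU|exact: setUSS|].
by have := mass_setU U V oU oV; lra.
Qed.

(** Small open neighborhoods with geometrically decreasing masses cover the compact space, so
    finitely many do and the total mass is 0. Applying this to [f] and to its opposite gives
    [L f = 0]. *)
Lemma mass_null_cover_eq0 (N : nat -> set T) : (forall n, mass_null (N n)) ->
  \bigcup_n N n = setT -> forall f, continuous f -> L f = 0.
Proof.
move=> nN cN.
have mT : mass setT <= 0.
  apply/ler_addgt0Pr => e e0; rewrite add0r.
  have /choice [U hU] : forall n, exists U,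
      [/\ open U, N n `<=` U & mass U < e / 2 ^+ n.+1].
    by move=> n; apply: nN; rewrite divr_gt0 // exprn_gt0.
  have oU n : open (U n) by case: (hU n).
  have [|n hn] := closed_cover_nat setT U closedT oU.
    by rewrite -cN => x [n _ Nx]; exists n => //; case: (hU n) => _ + _; apply.
  apply: le_trans (mass_mono _ _ hn) _.
  by apply: mass_bigcup_halves (ltW e0) oU _ => i; apply: ltW; case: (hU i).
have L0 f : continuous f -> L f <= 0.
  move=> cf; have [M M0 fM] := continuous_bounded _ cT cf.
  apply: le_trans (mass_scale setT M f M0 cf fM _) _; first by move=> x [].
  by rewrite mulr_ge0_le0.
move=> f cf; have cNf : continuous (-1 *: f) by move=> x; apply: cvgZl_tmp; exact: cf.
have := L0 _ cf; have := L0 _ cNf; rewrite functionalZ //; lra.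
Qed.

End VariationMass.

(** * Ridge functions and cycles *)

Lemma set_type_compact (U : topologicalType) (X : set U) :
  compact X -> compact [set: X].
Proof.
rewrite !compact_near_coveringP => cX J F P FF cover.
(* Quantifying over membership proofs turns [P i] into a predicate on all of [U], vacuous off
   [X]. *)
pose Q i v := forall h : v \in X, P i (exist _ v h).
have : \forall i \near F, X `<=` Q i.
  apply: cX => v Xv.
  have [[A B] /= [+ FB] AB] := cover (exist _ v (mem_set Xv)) I.
  rewrite nbhsE => -[_ [[W oW <-] Wv] WA].
  exists (W, B) => /=; first by split => //; exact: open_nbhs_nbhs.
  by move=> [u i] /= [Wu Bi] h; apply: (AB (exist _ u h, i)); split => //; exact: WA.
by apply: filterS => i QX [v h] _; exact: QX (set_mem h) h.
Qed.

Lemma set_type_hausdorff (U : topologicalType) (X : set U) :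
  hausdorff_space U -> hausdorff_space X.
Proof.
rewrite !open_hausdorff => hU x y xy.
have [|[A B] /= [xA yB] [oA oB AB]] := hU (val x) (val y).
  by rewrite (inj_eq val_inj).
exists (val @^-1` A, val @^-1` B) => /=; first by split; rewrite inE; exact: set_mem.
split; [by exists A|by exists B|].
by rewrite -preimage_setI (eqP AB) preimage_set0.
Qed.

Section Ridge.
Context {R : realType} {d : nat}.
Implicit Types (w x : 'rV[R]_d) (X : set 'rV[R]_d) (sigma : R -> R).

Lemma dotZ (t : R) w x : dot (t *: w) x = t * dot w x.
Proof.
by rewrite /dot mulr_sumr; apply: eq_bigr => l _; rewrite mxE mulrA.
Qed.

Lemma dot_continuous w : continuous (dot w).
Proof.
apply: (@continuous_big _ 'I_d +%R 0 xpredT (@add_continuous R)) => l _ x.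
apply: (@continuousM _ _ (fun=> w ord0 l) (fun x : 'rV[R]_d => x ord0 l)).
  exact: cst_continuous.
exact: coord_continuous.
Qed.

Lemma set_val_continuous X : continuous (val : X -> 'rV[R]_d).
Proof. exact: initial_continuous. Qed.

Lemma neuron_continuous sigma w theta : continuous sigma ->
  continuous (neuron sigma w theta).
Proof.
move=> cs x; apply: (@continuous_comp _ _ _ (fun x => dot w x - theta) sigma).
  apply: (@continuousB _ _ _ (dot w) (fun=> theta)); first exact: dot_continuous.
  exact: cst_continuous.
exact: cs.
Qed.

Lemma lin_span_comb (V : lmodType R) (A : set V) (c : R) u v :
  lin_span A u -> lin_span A v -> lin_span A (c *: u + v).
Proof.
move=> [m [a [f [Af ->]]]] [n [b [g [Ag ->]]]].
exists (m + n)%N,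
  (fun j : 'I_(m + n) =>
     match fintype.split j with inl i => c * a i | inr i => b i end),
  (fun j : 'I_(m + n) =>
     match fintype.split j with inl i => f i | inr i => g i end).
split; first by move=> j; case: (fintype.split j).
rewrite big_split_ord scaler_sumr; congr (_ + _); apply: eq_bigr => j _.
  by rewrite (unsplitK (inl j)) scalerA.
by rewrite (unsplitK (inr j)).
Qed.

Lemma networks_on_comb X sigma (W : set 'rV[R]_d) (c : R) f g :
  networks_on X sigma W f -> networks_on X sigma W g ->
  networks_on X sigma W (c *: f + g).
Proof.
move=> [u Nu <-] [v Nv <-]; exists (c *: u + v) => //.
exact: lin_span_comb.
Qed.

Lemma networks_on_neuron X sigma (W : set 'rV[R]_d) w theta : W w ->
  networks_on X sigma W (sigL X (neuron sigma w theta)).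
Proof.
move=> Ww; exists (neuron sigma w theta) => //.
exists 1%N, (fun=> 1), (fun=> neuron sigma w theta); split.
  by move=> _; exists w, theta.
by rewrite big_ord1 scale1r.
Qed.

Lemma networks_on0 X sigma (W : set 'rV[R]_d) : networks_on X sigma W 0.
Proof.
exists 0 => //; exists 0%N, (fun=> 0), (fun=> 0); split; first by case.
by rewrite big_ord0.
Qed.

Lemma networks_on_continuous X sigma (W : set 'rV[R]_d) g :
  continuous sigma -> networks_on X sigma W g -> continuous g.
Proof.
move=> cs [_ [n [c [u [Au ->]]]] <-].
apply/subspace_sigL_continuousP; apply: continuous_subspaceT.
rewrite (_ : \sum_(j < n) c j *: u j = fun y => \sum_(j < n) c j * u j y); last first.
  by apply/funext => y; rewrite fct_sumE.
apply: (@continuous_big _ 'I_n +%R 0 xpredT (@add_continuous R)) => j _ y.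
apply: (@continuousM _ _ (fun=> c j) (u j)); first exact: cst_continuous.
by have [w [theta [_ ->]]] := Au j; exact: neuron_continuous.
Qed.

End Ridge.

(** The continuous [g] with [L (g \o p) = 0] form a space closed under locally uniform limits,
    because [p] has bounded range and [L] is contractive; [dilation_closure_full] applies to it. *)
Lemma ridge_annihilator (R : realType) (T : topologicalType)
    (L : (T -> R) -> R) (p : T -> R) (sigma : R -> R) :
  compact [set: T] -> contractive_functional L -> continuous p ->
  continuous sigma ->
  ~ (exists q : {poly R}, forall t, sigma t = q.[t]) ->
  (forall t b, L ((fun s => sigma (t * s + b)) \o p) = 0) ->
  forall g : R -> R, continuous g -> L (g \o p) = 0.
Proof.
move=> cT cL cp cs npoly Ls.
have comp_cont (g : R -> R) : continuous g -> continuous (g \o p).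
  by move=> cg x; apply: continuous_comp; [exact: cp|exact: cg].
suff h g : continuous g -> continuous g /\ L (g \o p) = 0.
  by move=> g /h[].
move: g; apply: (dilation_closure_full
  (fun g => continuous g /\ L (g \o p) = 0) _ _ _ sigma cs npoly).
- by split; [exact: cst_continuous|exact: (functional0 L cL)].
- move=> c f g [cf Lf] [cg Lg]; split.
    by move=> x; apply: cvgD; [apply: cvgZl_tmp; exact: cf|exact: cg].
  have := cL.1 c _ _ (comp_cont _ cf) (comp_cont _ cg).
  by rewrite Lf Lg mulr0 addr0.
- move=> f cf happrox; split => //; apply/eqP; rewrite -normr_le0.
  apply/ler_addgt0Pr => e e0; rewrite add0r.
  have [b b0 pb] := continuous_bounded p cT cp.
  have [g [cg Lg] fg] := happrox b e e0.
  have := functionalB L cL _ _ (comp_cont _ cf) (comp_cont _ cg).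
  rewrite Lg subr0 => <-; apply: cL.2; first exact: ltW.
    by move=> x; apply: cvgB; [exact: comp_cont cf x|exact: comp_cont cg x].
  by move=> x; exact: fg.
- move=> t b; split => // x.
  apply: (@continuous_comp _ _ _ (fun s => t * s + b) sigma); last exact: cs.
  by apply: cvgD; [apply: cvgM; [exact: cvg_cst|exact: cvg_id]|exact: cvg_cst].
Qed.

(** * The two implications for ridge networks *)

Section RidgeNetworks.
Context {R : realType} {d k : nat} (sigma : R -> R).
Context (a : 'I_k -> 'rV[R]_d) (X : set 'rV[R]_d).
Hypotheses (cs : continuous sigma) (cX : compact X).

Let cT : compact [set: X] := set_type_compact _ _ cX.

Let hT : hausdorff_space X := set_type_hausdorff _ _ (@norm_hausdorff _ _).

Lemma not_tau (Z : set 'rV[R]_d) x : Z x -> ~ tau a Z x ->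
  exists i, forall y, Z y -> Defs.proj a i y = Defs.proj a i x -> y = x.
Proof.
move=> Zx nx; apply: contrapT => ni; apply: nx => i _; split => //.
have [y [Zy yx xy]] : exists y, [/\ Z y, Defs.proj a i y = Defs.proj a i x & y <> x].
  apply: contrapT => ny; apply: ni; exists i => y Zy yx.
  by apply: contrapT => xy; apply: ny; exists y.
apply/card_subP; pose f (n : nat) := if n == 0%N then x else y.
exists (f @` `I_2); last first.
  by move=> _ [n _ <-]; rewrite /f; case: ifP => _.
apply: inj_card_eq => m n; rewrite !inE /=.
by case: m => [|[|//]]; case: n => [|[|//]] //= _ _; rewrite /f /= => /esym // /xy.
Qed.

Lemma dense_networks :
  ~ (exists p : {poly R}, forall t, sigma t = p.[t]) ->
  \bigcap_(n in [set n : nat | (1 <= n)%N]) iter n (tau a) X = set0 ->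
  dense_in_C (networks_on X sigma (union_of_lines a)).
Proof.
move=> npoly tau0; apply/(dense_in_CP _ cT) => f e e0.
pose D := networks_on X sigma (union_of_lines a).
apply: contrapT => far; have e20 : 0 < e / 2 by rewrite divr_gt0.
have cf : continuous f by exact: cts_fun.
have [|c g h Dg Dh|g Dg|g Dg fg|L [cL LD /eqP]] :=
  separating_functional D f (e / 2) cT cf e20.
- exact: networks_on0.
- exact: networks_on_comb.
- exact: networks_on_continuous Dg.
- have cg : continuous g by exact: networks_on_continuous Dg.
  apply: far; exists (mkcts cg : continuousType X R) => //.
  apply: (@le_lt_trans _ _ (e / 2)); last by lra.
  (* When [X] is empty, the norm is the supremum of the empty set, which is 0 by convention. *)
  rewrite /uniform_norm; have [[x _]|nX] := pselect (exists x : X, True).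
    by apply: ge_sup; [exists `|f x - g x|, x|move=> _ [y _ <-]; exact: fg].
  rewrite [X in sup X](_ : _ = set0) ?sup0 ?ltW //.
  by rewrite -subset0 => r [x _ _]; apply: nX; exists x.
apply; pose p i (x : X) := Defs.proj a i (val x).
have cp i : continuous (p i).
  apply/(@subspace_sigL_continuousP _ X _ (Defs.proj a i)).
  by apply: continuous_subspaceT; exact: dot_continuous.
have Lp i (g : R -> R) : continuous g -> L (g \o p i) = 0.
  apply: ridge_annihilator cT cL (cp i) cs npoly _ _ => t b.
  rewrite [X in L X](_ : _ = sigL X (neuron sigma (t *: a i) (- b))).
    by apply/LD/networks_on_neuron; exists i, t.
  by apply/funext => x; rewrite /sigL /neuron /= dotZ opprK.
pose dist (z : X * X) := `|val z.1 - val z.2|.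
have cdist : continuous dist.
  move=> z; apply: (@continuous_comp _ _ _
    (fun z : X * X => val z.1 - val z.2) Num.norm); last exact: norm_continuous.
  apply: (@continuousB _ _ _ (fun z : X * X => val z.1) (fun z => val z.2)).
    apply: (@continuous_comp _ _ _ (@fst X X) val); first exact: cvg_fst.
    exact: set_val_continuous.
  apply: (@continuous_comp _ _ _ (@snd X X) val); first exact: cvg_snd.
  exact: set_val_continuous.
have dist0 x y : dist (x, y) = 0 <-> x = y.
  split => [/eqP|->]; last by rewrite /dist subrr normr0.
  by rewrite normr_eq0 subr_eq0 => /eqP /val_inj.
pose N n := [set x : X | ~ iter n (tau a) X (val x)].
have nN n : mass_null L (N n).
  elim: n => [|n IH].
    apply: mass_null_sub (mass_null0 L cL) => x; apply; exact: set_valP.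
  pose Z := [set x : X | iter n (tau a) X (val x)].
  pose M i := ~` Z `|` [set x | forall y, Z y -> p i y = p i x -> y = x].
  have nM i : mass_null L (M i).
    by apply: (mass_null_unique_fiber L cT hT cL (p i) dist (cp i) cdist dist0 (Lp i)).
  (* A point lost at stage [n.+1] was lost before or is alone in its fiber for some direction
     [i]. *)
  apply: (@mass_null_sub _ _ L _ (N n `|` \big[setU/set0]_(i < k) M i)).
    move=> x nx; have [Zx|] := pselect (Z x); last by left.
    have [i hi] := not_tau _ _ Zx nx; right; rewrite -bigcup_seq.
    exists i; first by rewrite /= mem_index_enum.
    right => y Zy yx; apply/val_inj/hi => //.
  apply: (mass_null_setU L cT hT cL) => //; elim/big_ind : _ => //.
  - exact: (mass_null0 L cL).
  - by move=> A B; exact: (mass_null_setU L cT hT cL).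
apply: (mass_null_cover_eq0 L cT hT cL N nN) => //.
apply/seteqP; split => // x _; apply: contrapT => nx.
suff : (set0 : set 'rV[R]_d) (val x) by [].
by rewrite -tau0 => n _; apply: contrapT => h; apply: nx; exists n.
Qed.

(** Evaluate the vanishing combination at each distinct value [v] of the projections, weight it by
    [phi v], and exchange the sums; [undup] makes each value count once. *)
Lemma cycle_ridge_sum n (x : 'I_n -> 'rV[R]_d) (lambda : 'I_n -> R) i
    (phi : R -> R) :
  \sum_(j < n) lambda j *: (\1_[set dot (a i) (x j)] : R -> R) = 0 ->
  \sum_(j < n) lambda j * phi (dot (a i) (x j)) = 0.
Proof.
move=> h; pose y j := dot (a i) (x j); pose s := undup (map y (enum 'I_n)).
have ys j : y j \in s by rewrite mem_undup map_f // mem_enum.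
transitivity (\sum_(v <- s) phi v *
    (\sum_(j < n) lambda j *: (\1_[set y j] : R -> R)) v); last first.
  by rewrite h; apply: big1 => v _; rewrite mulr0.
under [RHS]eq_bigr do rewrite fct_sumE mulr_sumr.
rewrite exchange_big /=; apply: eq_bigr => j _.
rewrite (bigD1_seq (y j)) ?undup_uniq //= big1_seq ?addr0.
  have -> : (lambda j *: \1_[set y j]) (y j) = lambda j * \1_[set y j] (y j) by [].
  by rewrite indicE mem_set // mulr1 mulrC.
move=> v /andP[vy _].
have -> : (lambda j *: \1_[set y j]) v = lambda j * \1_[set y j] v by [].
rewrite indicE memNset ?mulr0 ?mulr0 //= => vE.
by rewrite vE eqxx in vy.
Qed.

Lemma cycle_annihilates_networks n (t : 'I_n -> X) (lambda : 'I_n -> R) g :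
  (forall i, \sum_(j < n) lambda j *:
    (\1_[set dot (a i) (val (t j))] : R -> R) = 0) ->
  networks_on X sigma (union_of_lines a) g ->
  \sum_(j < n) lambda j * g (t j) = 0.
Proof.
move=> h [_ [m [c [u [Au ->]]]] <-].
under eq_bigr do rewrite /sigL /= fct_sumE mulr_sumr.
rewrite exchange_big /=; apply: big1 => l _.
have [_ [theta [[i [s ->]] ->]]] := Au l.
under eq_bigr do rewrite fctE /neuron dotZ.
by have := cycle_ridge_sum _ _ _ i (fun v => c l * sigma (s * v - theta)) (h i).
Qed.

Lemma no_cycle_of_dense :
  dense_in_C (networks_on X sigma (union_of_lines a)) -> ~ contains_cycle a X.
Proof.
move=> /(dense_in_CP _ cT) dens [n [x [Xx [n0 xinj [lambda [l0 hl]]]]]].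
pose t j : X := exist _ (x j) (mem_set (Xx j)).
pose j0 := Ordinal n0.
(* This continuous function vanishes at every point of the cycle but [x j0], so the cycle functional
   takes a nonzero value on it. *)
pose f (y : X) : R := \prod_(j < n | j != j0) `|val y - x j|.
have cf : continuous f.
  have mulC : continuous (fun z : R * R => z.1 * z.2).
    by move=> z; apply: cvgM; [exact: cvg_fst|exact: cvg_snd].
  apply: (continuous_big mulC) => j _ y.
  apply: (@continuous_comp _ _ _ (fun y : X => val y - x j) Num.norm); last first.
    exact: norm_continuous.
  apply: (@continuousB _ _ _ (fun y : X => val y) (fun=> x j)).
    exact: set_val_continuous.
  exact: cst_continuous.
have f0 j : j != j0 -> f (t j) = 0.
  by move=> jj0; rewrite /f (bigD1 j) //= subrr normr0 mul0r.
have fj0 : f (t j0) != 0.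
  apply/prodf_neq0 => j jj0; rewrite normr_eq0 subr_eq0; apply: contra jj0.
  by move=> /eqP /xinj ->.
have Lf : \sum_(j < n) lambda j * f (t j) = lambda j0 * f (t j0).
  by rewrite (bigD1 j0) //= big1 ?addr0 // => j /f0 ->; rewrite mulr0.
pose c : R := `|lambda j0 * f (t j0)|.
have c0 : 0 < c by rewrite normr_gt0 mulf_neq0.
pose S : R := \sum_(j < n) `|lambda j|.
have S1 : 0 < S + 1 by rewrite ltr_wpDl // sumr_ge0.
(* The cycle functional has norm at most [S], so it would differ on [f] and [g] by at most
   [S * (c / (S + 1)) < c], although it vanishes on [g] and has absolute value [c] on [f]. *)
have [g Mg fg] := dens (mkcts cf) _ (divr_gt0 c0 S1).
have cg : continuous g by exact: cts_fun.
have fgx y : `|f y - g y| <= c / (S + 1).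
  apply: le_trans (ltW fg); apply: ub_le_sup; last by exists y.
  have [|K _ hK] := @continuous_bounded R X (f - (g : X -> R)) cT.
    by move=> z; apply: (@continuousB _ _ _ f g); [exact: cf|exact: cg].
  by exists K => _ [z _ <-]; exact: hK.
suff : c < c by rewrite ltxx.
have := cycle_annihilates_networks n t lambda _ hl Mg => Lg.
have {1}-> : c = `|\sum_(j < n) (lambda j * f (t j) - lambda j * g (t j))|.
  by rewrite sumrB Lg subr0 Lf.
apply: le_lt_trans (ler_norm_sum _ _ _) _.
apply: (@le_lt_trans _ _ (S * (c / (S + 1)))).
  rewrite /S mulr_suml; apply: ler_sum => j _.
  by rewrite -mulrBr normrM ler_wpM2l //; exact: fgx.
by rewrite mulrCA gtr_pMr // ltr_pdivrMr // mul1r; lra.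
Qed.

End RidgeNetworks.

Theorem theorem5p3 (R : realType) (d k : nat) (sigma : R -> R)
    (a : 'I_k -> 'rV[R]_d) (X : set 'rV[R]_d)
    (hk : (0 < k)%N)
    (sigma_cont : continuous sigma)
    (sigma_not_poly : ~ exists p : {poly R}, forall t : R, sigma t = p.[t])
    (a_neq0 : forall i : 'I_k, a i != 0)
    (X_compact : compact X) :
  (\bigcap_(n in [set n : nat | (1 <= n)%N]) iter n (tau a) X = set0 ->
     dense_in_C (networks_on X sigma (union_of_lines a)))
  /\
  (dense_in_C (networks_on X sigma (union_of_lines a)) ->
     ~ contains_cycle a X).
Proof.
by split; [exact: dense_networks|exact: no_cycle_of_dense].
Qed.
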